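(* Assume all the standing assumptions (C1)--(C14) listed in the context. Then there exists $h_0\in(0,1)$ such that for all $h\in(0,h_0)$ (of the form $h=T/N$, $N\in\mathbb{N}$) there exists a unique solution $(\theta_{n+1},\varphi_{n+1})$, $n=0,\dots,N-1$, of the discrete problem $(\mathrm{P})_n$ described in the context, satisfying $$\theta_{n+1}\in D(A_1),\qquad \varphi_{n+1}\in D(B)\cap D(A_2)\qquad\text{for } n=0,\dots,N-1.$$
   Context: Fix $T>0$. Standing assumptions: (C1) $V$ and $H$ are real Hilbert spaces with $V\subset H$, the embedding being dense, continuous and compact; $H$ is identified with its dual, so $V\subset H\subset V^*$. (C2) $V_1,V_2$ are closed linear subspaces of $V$ (with the norm of $V$), dense in $H$ and reflexive. (C3) $L:H\to H$ is bounded linear, $(Lw,z)_H=(w,Lz)_H$ for all $w,z\in H$, and $(Lw,w)_H\ge c_L\|w\|_H^2$ for all $w\in H$, with a constant $c_L>0$. (C4) $A_1:D(A_1)\subset H\to H$ is a linear maximal monotone selfadjoint operator, $D(A_1)$ is a linear subspace of $H$ and $D(A_1)\subset V_1$. There is a bounded linear monotone operator $A_1^*:V_1\to V_1^*$ with $\langle A_1^*w,z\rangle_{V_1^*,V_1}=\langle A_1^*z,w\rangle_{V_1^*,V_1}$ for all $w,z\in V_1$ and $A_1^*w=A_1w$ for all $w\in D(A_1)$. For every $\alpha>0$ there is $\sigma_\alpha>0$ with $\langle A_1^*w,w\rangle_{V_1^*,V_1}+\alpha\|w\|_H^2\ge\sigma_\alpha\|w\|_{V_1}^2$ for all $w\in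 V_1$. (C5) For all $g\in H$ and $a>0$: if $\theta\in V_1$ satisfies $\theta+aA_1^*\theta=g$ in $V_1^*$, then $\theta\in D(A_1)$ and $\theta+aA_1\theta=g$ in $H$. (C6) $B:D(B)\subset H\to H$ and $A_2:D(A_2)\subset H\to H$ are linear maximal monotone selfadjoint operators ($D(B),D(A_2)$ linear subspaces of $H$) with $D(B)\cap D(A_2)\ne\emptyset$; $(Bw,A_2w)_H\ge0$ for all $w\in D(B)\cap D(A_2)$; $(Bw,A_2z)_H=(Bz,A_2w)_H$ for all $w,z\in D(B)\cap D(A_2)$; and $D(A_2)\subset V_2$. (C7) $\Phi:D(\Phi)\subset H\to H$ is a (single-valued) maximal monotone operator with $\Phi(0)=0$, $V\subset D(\Phi)$, and there are constants $p,q,C_\Phi>0$ with $\|\Phi w-\Phi z\|_H\le C_\Phi(1+\|w\|_V^p+\|z\|_V^q)\|w-z\|_V$ for all $w,z\in V$. (C8) There is a function $i:V\to[0,\infty)$ with $(\Phi w,w-z)_H\ge i(w)-i(z)$ for all $w,z\in V$. (C9) For every $\lambda>0$, the Yosida approximation $\Phi_\lambda=\lambda^{-1}(I-(I+\lambda\Phi)^{-1}):H\to H$ satisfies $\Phi_\lambda(0)=0$, $(\Phi_\lambda w,Bw)_H\ge0$ for all $w\in D(B)$, and $(\Phi_\lambda w,A_2w)_H\ge0$ for all $w\in D(A_2)$. (C10) $B^*:V_2\to V_2^*$ is a bounded linear monotone operator with $\langle B^*w,z\rangle_{V_2^*,V_2}=\langle B^*z,w\rangle_{V_2^*,V_2}$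 for all $w,z\in V_2$ and $B^*w=Bw$ for all $w\in D(B)\cap V_2$. (C11) $A_2^*:V_2\to V_2^*$ is a bounded linear monotone operator with $\langle A_2^*w,z\rangle_{V_2^*,V_2}=\langle A_2^*z,w\rangle_{V_2^*,V_2}$ for all $w,z\in V_2$ and $A_2^*w=A_2w$ for all $w\in D(A_2)$. For every $\alpha>0$ there is $\omega_\alpha>0$ with $\langle A_2^*w,w\rangle_{V_2^*,V_2}+\alpha\|w\|_H^2\ge\omega_\alpha\|w\|_{V_2}^2$ for all $w\in V_2$. (C12) For all $g\in H$, $a,b,c,d>0$, $\lambda>0$: if $\varphi_\lambda\in V_2$ satisfies $L\varphi_\lambda+aB^*\varphi_\lambda+bA_2^*\varphi_\lambda+c\Phi_\lambda\varphi_\lambda+d\mathcal{L}\varphi_\lambda=g$ in $V_2^*$, then $\varphi_\lambda\in D(B)\cap D(A_2)$ and $L\varphi_\lambda+aB\varphi_\lambda+bA_2\varphi_\lambda+c\Phi_\lambda\varphi_\lambda+d\mathcal{L}\varphi_\lambda=g$ in $H$. (C13) $\mathcal{L}:H\to H$ is Lipschitz continuous with Lipschitz constant $C_{\mathcal{L}}>0$. (C14) $\theta_0\in V_1$, $\varphi_0\in D(B)\cap D(A_2)$, $v_0\in D(B)\cap V_2$, $f\in L^2(0,T;H)$. Discrete problem $(\mathrm{P})_n$. For $N\in\mathbb{N}$ put $h=T/N$ and $f_k:=\frac1h\int_{(k-1)h}^{kh}f(s)\,ds$ for $k=1,\dots,N$. Starting from the given $\theta_0,\varphi_0,v_0$,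 find $(\theta_{n+1},\varphi_{n+1})$ such that for $n=0,\dots,N-1$ (equations in $H$) $$\delta_h\theta_n+\delta_h\varphi_n+A_1\theta_{n+1}=f_{n+1},$$ $$Lz_{n+1}+Bv_{n+1}+A_2\varphi_{n+1}+\Phi\varphi_{n+1}+\mathcal{L}\varphi_{n+1}=\theta_{n+1},$$ $$z_0=z_1,\quad z_{n+1}=\delta_hv_n,\quad v_{n+1}=\delta_h\varphi_n,$$ where $\delta_h\theta_n:=\frac{\theta_{n+1}-\theta_n}{h}$, $\delta_h\varphi_n:=\frac{\varphi_{n+1}-\varphi_n}{h}$, $\delta_hv_n:=\frac{v_{n+1}-v_n}{h}$. *)

(* Defs.v *)
From HB Require Import structures.
From mathcomp Require Import all_boot all_order all_algebra sesquilinear.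
From mathcomp Require Import all_classical all_reals all_analysis.

Set Implicit Arguments.
Unset Strict Implicit.
Unset Printing Implicit Defensive.

Import Order.TTheory GRing.Theory Num.Theory.
Import numFieldNormedType.Exports.

Local Open Scope classical_set_scope.
Local Open Scope ring_scope.

(* A real Hilbert space is a [completeNormedModType R] together with an inner
   product [ip : {dot H for idfun}] inducing its norm. *)
Definition induces_norm (R : realType) (H : normedModType R)
    (ip : {dot H for idfun}) : Prop :=
  forall u : H, `|u| ^+ 2 = ip u u.

Definition linear_subspace (R : realType) (U : lmodType R) (W : set U) : Prop :=
  W 0 /\ (forall (a : R) (u v : U), W u -> W v -> W (a *: u + v)).

Section DualOfSubspace.
Variables (R : realType) (V : normedModType R) (W : set V).

(* An element of the dual W^* of the subspace W is represented by a function on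
   V of which only the values on W matter; two such functions stand for the same
   element of W^* when they agree on W. [dual_bound F M] says that M bounds the
   dual norm of F. *)
Definition dual_bound (F : V -> R) (M : R) : Prop :=
  0 <= M /\ forall v, W v -> `|F v| <= M * `|v|.

Definition dual_space : set (V -> R) :=
  [set F | (forall (a : R) (u v : V), W u -> W v ->
              F (a *: u + v) = a * F u + F v)
         /\ exists M, dual_bound F M].

(* The canonical map from W to W^** is onto. By boundedness, a functional Psi
   as below only depends on the restriction of F to W. *)
Definition reflexive_subspace : Prop :=
  forall Psi : (V -> R) -> R,
    (forall (a : R) (F G : V -> R), dual_space F -> dual_space G ->
       Psi (fun v => a * F v + G v) = a * Psi F + Psi G) ->
    (exists C : R, forall F M, dual_space F -> dual_bound F M ->
       `|Psi F| <= C * M) ->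
    exists2 v : V, W v & forall F, dual_space F -> Psi F = F v.

(* S : W -> W^* is encoded by (w, z) |-> <S w, z>. *)
Definition bounded_linear_to_dual (S : V -> V -> R) : Prop :=
  [/\ forall w, W w -> dual_space (S w),
      forall (a : R) (u v z : V), W u -> W v -> W z ->
        S (a *: u + v) z = a * S u z + S v z
    & exists C : R, 0 <= C /\ forall w, W w -> dual_bound (S w) (C * `|w|)].

Definition monotone_to_dual (S : V -> V -> R) : Prop :=
  forall w z, W w -> W z -> 0 <= S w (w - z) - S z (w - z).

Definition symmetric_to_dual (S : V -> V -> R) : Prop :=
  forall w z, W w -> W z -> S w z = S z w.

End DualOfSubspace.

Section Operators.
Variables (R : realType) (H : completeNormedModType R) (ip : {dot H for idfun}).

(* A single-valued operator D(A) -> H with D(A) a subset of H; the values of the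
   function outside [dom] are irrelevant. *)
Record operator := Operator { dom : set H ; fct :> H -> H }.

Implicit Types (A : operator) (G : set (H * H)).

Definition graph A : set (H * H) := [set p | dom A p.1 /\ p.2 = A p.1].

Definition monotone_graph G : Prop :=
  forall p q, G p -> G q -> 0 <= ip (p.2 - q.2) (p.1 - q.1).

Definition maximal_monotone A : Prop :=
  monotone_graph (graph A) /\
  forall G, monotone_graph G -> graph A `<=` G -> G `<=` graph A.

Definition linear_operator A : Prop :=
  linear_subspace (dom A) /\
  forall (a : R) (u v : H), dom A u -> dom A v ->
    A (a *: u + v) = a *: A u + A v.

Definition adjoint_graph A : set (H * H) :=
  [set p | forall w, dom A w -> ip (A w) p.1 = ip w p.2].

Definition selfadjoint A : Prop :=
  dense (dom A) /\ adjoint_graph A = graph A.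

(* For a maximal monotone A and 0 < lam the equation below has exactly one
   solution u for every x (Minty), so that the choice is the true resolvent. *)
Definition resolvent A (lam : R) (x : H) : H :=
  get [set u : H | dom A u /\ u + lam *: A u = x].

Definition yosida A (lam : R) (x : H) : H := lam^-1 *: (x - resolvent A lam x).

End Operators.

Section Bochner.
Variables (R : realType) (H : completeNormedModType R).
Local Notation mu := (@lebesgue_measure R).

Definition simple_function (s : R -> H) : Prop :=
  finite_set (range s) /\
  forall y, measurable (s @^-1` [set y] : set (measurableTypeR R)).

(* Only meaningful if the Lebesgue measure of D is finite. *)
Definition simple_integral (D : set R) (s : R -> H) : H :=
  \sum_(y \in range s) fine (mu (D `&` s @^-1` [set y])) *: y.

Definition simple_approximation (D : set R) (f : R -> H) (s : nat -> R -> H) :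
    Prop :=
  (forall n, simple_function (s n)) /\
  {ae mu, forall t, D t -> s ^~ t @ \oo --> f t}.

Definition strongly_measurable (D : set R) (f : R -> H) : Prop :=
  exists s, simple_approximation D f s.

Definition is_bochner_integral (D : set R) (f : R -> H) (I : H) : Prop :=
  exists s : nat -> R -> H,
    [/\ simple_approximation D f s,
        ((fun n => (\int[mu]_(t in D) `|f t - s n t|%:E)%E) @ \oo --> 0%E)
      & (fun n => simple_integral D (s n)) @ \oo --> I].

Definition bochner_integral (D : set R) (f : R -> H) : H :=
  get (is_bochner_integral D f).

Definition square_integrable (D : set R) (f : R -> H) : Prop :=
  strongly_measurable D f /\ (\int[mu]_(t in D) (`|f t| ^+ 2)%:E < +oo)%E.

Definition time_average (f : R -> H) (h : R) (k : nat) : H :=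
  h^-1 *: bochner_integral `](k%:R - 1) * h, k%:R * h[ f.

End Bochner.

Section DiscreteProblem.
Variables (R : realType) (H : completeNormedModType R).

Definition diff_quot (h : R) (u : nat -> H) (n : nat) : H :=
  h^-1 *: (u n.+1 - u n).

(* Only the values of theta and phi at the indices 0, ..., N matter. The domain
   conditions are those needed for the equations to make sense in H. *)
Definition discrete_solution (A1 B A2 Phi : operator H) (L calL : H -> H)
    (theta0 phi0 v0 : H) (f : R -> H) (h : R) (N : nat)
    (theta phi : nat -> H) : Prop :=
  [/\ theta 0%N = theta0, phi 0%N = phi0
    & exists v z : nat -> H,
      [/\ v 0%N = v0, z 0%N = z 1%N
        & forall n, (n < N)%N ->
          [/\ dom A1 (theta n.+1) /\ dom B (v n.+1),
              dom A2 (phi n.+1) /\ dom Phi (phi n.+1),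
              diff_quot h theta n + diff_quot h phi n + A1 (theta n.+1)
                = time_average f h n.+1,
              L (z n.+1) + B (v n.+1) + A2 (phi n.+1) + Phi (phi n.+1)
                + calL (phi n.+1) = theta n.+1
            & z n.+1 = diff_quot h v n /\ v n.+1 = diff_quot h phi n]]].

End DiscreteProblem.

(* Main.v *)
Require Import Defs.
From HB Require Import structures.
From mathcomp Require Import all_boot all_order all_algebra sesquilinear.
From mathcomp Require Import all_classical all_reals all_analysis.
From mathcomp Require Import ring lra.

(** Eliminating the velocity and the temperature turns one time step into a
    single equation.  Multiplying the first equation by h and writing J for the
    resolvent of A1 at h, one has theta = J (G - phi) with G known from the
    previous step; multiplying the second one by h^2 then gives
      L phi + h B phi + h^2 A2 phi + h^2 Phi phi + P phi = 0,
      P phi = h^2 (calL phi - J (G - phi)) - g,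
    with g known.  Since J is monotone, the only non-monotone term is calL,
    which costs h^2 CcalL; as L gains cL, the map L + P is strongly monotone as
    soon as h^2 CcalL < cL, and this is all that h0 has to ensure.  Uniqueness
    is then the energy estimate for the difference of two solutions
    ([one_step_unique]).

    For existence, Phi is first replaced by its Yosida approximation. The
    equation becomes a Lipschitz perturbation of the symmetric coercive form
    given by L, B* and A2* on V2: its weak form is solved by Lax-Milgram and a
    damped fixed point iteration in H ([semilinear_solvable]), and the
    regularity hypothesis makes the weak solution a strong one. Testing with B
    phi and A2 phi, where every cross term has a sign, bounds B phi, A2 phi and
    the Yosida term independently of the parameter. The solutions then form a
    Cauchy sequence in H, because the Yosida approximations are monotone up to
    an error that vanishes with the parameter ([yosida_almost_monotone]); the
    selfadjoint terms pass to weak limits, and the maximality of Phi identifies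
    the limit of the Yosida term ([vanishing_yosida]).

    Resolvents are meaningful only because a maximal monotone operator A has
    I + lam A onto.  This is Minty's theorem ([minty_graph]); it and the
    Lax-Milgram lemma are obtained by minimising a uniformly convex functional,
    whose minimising sequences are Cauchy. *)

Set Implicit Arguments.
Unset Strict Implicit.
Unset Printing Implicit Defensive.

Import Order.TTheory GRing.Theory Num.Theory.
Import numFieldNormedType.Exports.

Local Open Scope classical_set_scope.
Local Open Scope ring_scope.

(** * Inner products and sequences *)

Section InnerProduct.
Variables (R : realType) (H : normedModType R) (ip : {dot H for idfun}).
Hypothesis hilb : induces_norm ip.

Lemma ipC x y : ip x y = ip y x.
Proof. by rewrite hermC /= expr0 mul1r. Qed.

Lemma ipDl x y z : ip (x + y) z = ip x z + ip y z.
Proof. exact: linearDl. Qed.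

Lemma ipZl a x z : ip (a *: x) z = a * ip x z.
Proof. exact: linearZl_LR. Qed.

Lemma ipNl x z : ip (- x) z = - ip x z.
Proof. exact: linearNl. Qed.

Lemma ip0l z : ip 0 z = 0.
Proof. exact: linear0l. Qed.

Lemma ipDr x y z : ip z (x + y) = ip z x + ip z y.
Proof. by rewrite ipC ipDl !(ipC z). Qed.

Lemma ipZr a x z : ip z (a *: x) = a * ip z x.
Proof. by rewrite ipC ipZl (ipC z). Qed.

Lemma ipNr x z : ip z (- x) = - ip z x.
Proof. by rewrite ipC ipNl (ipC z). Qed.

Lemma ip0r z : ip z 0 = 0.
Proof. by rewrite ipC ip0l. Qed.

Definition ipE := (ipDl, ipDr, ipNl, ipNr, ipZl, ipZr, ip0l, ip0r).

Lemma ip_ge0 x : 0 <= ip x x.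
Proof. by rewrite -hilb sqr_ge0. Qed.

Lemma ip_inj x y : (forall w, ip x w = ip y w) -> x = y.
Proof.
move=> xy; apply/subr0_eq/normr0_eq0/eqP; rewrite -sqrf_eq0 hilb.
by rewrite ipDl ipNl xy subrr.
Qed.

Lemma cauchy_schwarz x y : ip x y <= `|x| * `|y|.
Proof.
have [->|x0] := eqVneq x 0; first by rewrite ip0l normr0 mul0r.
have [->|y0] := eqVneq y 0; first by rewrite ip0r normr0 mulr0.
have := ip_ge0 (`|y| *: x - `|x| *: y).
have px : 0 < `|x| by rewrite normr_gt0.
have py : 0 < `|y| by rewrite normr_gt0.
rewrite !ipE -!hilb (ipC y x) => h.
rewrite -(ler_pM2l (mulr_gt0 px py)); nra.
Qed.

Lemma cauchy_schwarz_norm x y : `|ip x y| <= `|x| * `|y|.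
Proof.
rewrite ler_norml cauchy_schwarz andbT lerNl -ipNl.
by rewrite (le_trans (cauchy_schwarz _ _))// normrN.
Qed.

Lemma sqr_normD x y : `|x + y| ^+ 2 = `|x| ^+ 2 + 2 * ip x y + `|y| ^+ 2.
Proof. by rewrite !hilb !ipE (ipC y x); ring. Qed.

Lemma cvg_ip (T : Type) (F : set_system T) (FF : Filter F) (x y : T -> H) a b :
  x t @[t --> F] --> a -> y t @[t --> F] --> b ->
  ip (x t) (y t) @[t --> F] --> ip a b.
Proof.
move=> xa yb.
have pol u v : ip u v = 2^-1 * (`|u + v| ^+ 2 - `|u| ^+ 2 - `|v| ^+ 2).
  by rewrite sqr_normD; field.
have sqrC (u : T -> H) c : u t @[t --> F] --> c ->
    `|u t| ^+ 2 @[t --> F] --> `|c| ^+ 2.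
  by move=> uc; rewrite expr2; apply: cvgM; exact: cvg_norm.
under eq_cvg do rewrite pol.
rewrite pol; apply: cvgMr; apply: cvgB; first apply: cvgB; apply: sqrC => //.
exact: cvgD.
Qed.

End InnerProduct.

Lemma le_of_sqr (R : realFieldType) (c C t : R) :
  0 < c -> 0 <= t -> 0 <= C -> c * t ^+ 2 <= C * t -> t <= c^-1 * C.
Proof.
move=> c0; rewrite le_eqVlt => /predU1P[<- C0 _|t0 _].
  by rewrite mulr_ge0// invr_ge0 ltW.
by rewrite expr2 mulrA ler_pM2r// ler_pdivlMl.
Qed.

(** The rate 1/(n+1) serves two purposes: it is the excess of a minimising
    sequence over the infimum, and the parameter of the Yosida approximation
    along which the regularised solutions are followed. *)
Lemma cvg_of_sqr_dist (R : realType) (V : completeNormedModType R)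
    (u : nat -> V) (K : R) :
  (forall n m, `|u n - u m| ^+ 2 <= K * (harmonic n + harmonic m)) ->
  cvgn u.
Proof.
move=> uK; apply: cauchy_cvg; apply: cauchy_exP => e e0.
have K0 : 0 <= K.
  have h0 : (0 : R) < harmonic 0%N + harmonic 0%N.
    by rewrite addr_gt0 ?harmonic_gt0.
  by have := uK 0%N 0%N; rewrite subrr normr0 expr2 mulr0 pmulr_lge0.
have : K * 2 * harmonic n @[n --> \oo] --> (0 : R).
  by rewrite -(mulr0 (K * 2)); apply: cvgMr; exact: cvg_harmonic.
have e20 : 0 < e ^+ 2 by rewrite exprn_gt0.
move=> /cvgr0_norm_lt/(_ _ e20)[n _ /(_ _ (leqnn n))/= ne].
exists (u n); exists n => //= m nm; rewrite -ball_normE /=.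
rewrite -(@ltr_pXn2r _ 2)// ?nnegrE// ?(ltW e0)//.
apply: le_lt_trans (uK _ _) _; apply: le_lt_trans ne.
apply: le_trans (ler_norm _); rewrite -mulrA.
rewrite ler_wpM2l// mulr_natl mulr2n lerD2l /harmonic /=.
by rewrite lef_pV2 ?posrE ?ltr0n// ler_nat ltnS.
Qed.

Lemma minimizing_sequence (R : realType) (E : Type) (C : set E) (J : E -> R)
    (m0 : R) :
  C !=set0 -> (forall x, C x -> m0 <= J x) ->
  exists (m : R) (x : nat -> E),
    [/\ forall y, C y -> m <= J y, forall n, C (x n)
      & forall n, J (x n) <= m + harmonic n].
Proof.
move=> [c Cc] m0J.
have JC : has_inf (J @` C).
  by split; [exists (J c), c|exists m0 => _ [y Cy <-]; exact: m0J].
have ex n : exists x, C x /\ J x <= inf (J @` C) + harmonic n.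
  have [_ [x Cx <-] /ltW h] := inf_adherent (harmonic_gt0 n) JC.
  by exists x.
have [x xP] := choice ex.
exists (inf (J @` C)), x; split => [y Cy|n|n]; try by case: (xP n).
by apply: ge_inf; [case: JC|exists y].
Qed.
Lemma cvg_of_sqr_le (R : realType) (V : normedModType R) (u : nat -> V) (l : V)
    (K : R) :
  (forall n, `|u n - l| ^+ 2 <= K * harmonic n) -> u @ \oo --> l.
Proof.
move=> uK; apply/cvgrPdist_lt => e e0.
have : K * harmonic n @[n --> \oo] --> (0 : R).
  by rewrite -(mulr0 K); apply: cvgMr; exact: cvg_harmonic.
have e20 : 0 < e ^+ 2 by rewrite exprn_gt0.
move=> /cvgr0_norm_lt/(_ _ e20) near_e; near=> n.
rewrite distrC -(@ltr_pXn2r _ 2)// ?nnegrE// ?(ltW e0)//.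
apply: le_lt_trans (uK n) _; apply: le_lt_trans (ler_norm _) _.
by near: n.
Unshelve. all: by end_near. Qed.

(** * Symmetric forms and linear functionals *)

Section SymmetricForm.
Variables (R : realType) (V : completeNormedModType R) (W : set V).
Variables (S : V -> V -> R) (F : V -> R) (c C : R).
Hypothesis W_sub : linear_subspace W.
Hypothesis S_lin : forall (a : R) (u v z : V), W u -> W v -> W z ->
  S (a *: u + v) z = a * S u z + S v z.
Hypothesis S_sym : forall u v, W u -> W v -> S u v = S v u.
Hypothesis c_gt0 : 0 < c.
Hypothesis S_coercive : forall u, W u -> c * `|u| ^+ 2 <= S u u.
Hypothesis F_lin : forall (a : R) (u v : V), W u -> W v ->
  F (a *: u + v) = a * F u + F v.
Hypothesis F_bounded : forall u, W u -> `|F u| <= C * `|u|.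

Let J u := S u u - 2 * F u.

Let J_line (a : R) u v : W u -> W v ->
  J (a *: u + v) = J v + 2 * a * (S v u - F u) + a ^+ 2 * S u u.
Proof.
move=> Wu Wv; have Wuv := W_sub.2 a _ _ Wu Wv.
rewrite /J F_lin// S_lin// (S_sym Wu Wuv) (S_sym Wv Wuv) !S_lin//.
by rewrite (S_sym Wu Wv); ring.
Qed.

Let J_lb u : W u -> - (c^-1 * C ^+ 2) <= J u.
Proof.
move=> Wu; have := S_coercive Wu; have := F_bounded Wu.
rewrite ler_norml => /andP[_ FC]; rewrite /J => cS.
have : 0 <= c^-1 * (c * `|u| - C) ^+ 2.
  by rewrite mulr_ge0 ?sqr_ge0// invr_ge0 ltW.
have -> : c^-1 * (c * `|u| - C) ^+ 2 =
    c * `|u| ^+ 2 - 2 * (C * `|u|) + c^-1 * C ^+ 2.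
  by field; rewrite gt_eqF.
by lra.
Qed.

(** A minimising sequence of J u = S u u - 2 F u is Cauchy because the value of
    J at a midpoint falls below the mean value by S (u - v) (u - v) / 4, and
    the derivative of J along it tends to 0. Speaking of a sequence in W rather
    than of a minimiser covers both densely defined functionals, where S is the
    inner product, and the Lax-Milgram lemma, where W is closed. *)
Lemma form_minimizing_sequence : exists (u : nat -> V) (l : V),
  [/\ forall n, W (u n), u @ \oo --> l
    & forall z, W z -> S (u n) z @[n --> \oo] --> F z].
Proof.
have [|m [u [m_le Wu um]]] := @minimizing_sequence _ _ W J _ _ J_lb.
  by exists 0; exact: W_sub.1.
have S0 z : W z -> 0 <= S z z.
  by move=> /S_coercive; apply: le_trans; rewrite mulr_ge0 ?sqr_ge0// ltW.
have /cvg_ex[l ul] : cvgn u.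
  apply: (@cvg_of_sqr_dist _ _ _ (2 * c^-1)) => i j.
  have Wij : W (u i - u j).
    have := W_sub.2 (-1) _ _ (Wu j) (Wu i).
    by rewrite scaleN1r addrC.
  have := m_le _ (W_sub.2 2^-1 _ _ Wij (Wu j)).
  rewrite J_line//.
  have Ji : J (u i) = J (u j) + 2 * (S (u j) (u i - u j) - F (u i - u j))
      + S (u i - u j) (u i - u j).
    rewrite -[in LHS](subrK (u j) (u i)) -[u i - u j in LHS]scale1r J_line//.
    by ring.
  have := S_coercive Wij; have := um i; have := um j; rewrite Ji => h1 h2 h3 h4.
  rewrite -mulrA mulrCA ler_pdivlMl//.
  by lra.
exists u, l; split=> // z Wz.
apply: (@cvg_of_sqr_le _ _ _ _ (S z z + 1)) => n.
have s0 := S0 _ Wz; set s := S z z in s0 *.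
(* the step minimising, up to the + 1 that avoids a zero denominator, the
   quadratic t |-> J (u n + t z) *)
have := m_le _ (W_sub.2 (- ((S (u n) z - F z) / (s + 1))) _ _ Wz (Wu n)).
rewrite J_line// -/s real_normK ?num_real//; set d := _ - _ => h.
have s1 : 0 < s + 1 by lra.
have : 0 <= harmonic n - d ^+ 2 / (s + 1).
  have {h} := le_trans h (lerD (lerD (um n) (lexx _)) (lexx _)).
  rewrite -addrA -addrA lerDl.
  have : 0 <= d ^+ 2 / (s + 1) ^+ 2.
    by rewrite mulr_ge0 ?sqr_ge0// invr_ge0 sqr_ge0.
  have -> : harmonic n
      + (2 * - (d / (s + 1)) * d + (- (d / (s + 1))) ^+ 2 * s) =
     harmonic n - d ^+ 2 / (s + 1) - d ^+ 2 / (s + 1) ^+ 2.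
    by field; rewrite gt_eqF.
  by lra.
by rewrite subr_ge0 ler_pdivrMr// mulrC.
Qed.

Lemma lax_milgram (M : R) : closed W ->
  (forall u v, W u -> W v -> `|S u v| <= M * `|u| * `|v|) ->
  exists2 u, W u & forall z, W z -> S u z = F z.
Proof.
move=> W_closed SM.
have [u [l [Wu ul Sl]]] := form_minimizing_sequence.
have Wl : W l by apply: (closed_cvg W W_closed _ l ul); exact: nearW.
exists l => // z Wz; apply: cvg_unique (Sl _ Wz); first exact: Rhausdorff.
apply/subr_cvg0; apply: norm_cvg0.
have dE n : u n - l = -1 *: l + u n by rewrite scaleN1r addrC.
have Sd n : S (u n) z - S l z = S (u n - l) z by rewrite dE S_lin//; ring.
have Wd n : W (u n - l) by rewrite dE; apply: W_sub.2.
apply: (@squeeze_cvgr _ _ _ _ (fun=> 0) (fun n => M * `|u n - l| * `|z|)).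
- apply: nearW => n; rewrite normr_ge0/= Sd.
  exact: SM.
- exact: cvg_cst.
- rewrite -[X in _ --> X](mul0r `|z|) -(mulr0 M).
  apply: cvgMl; apply: cvgMr; rewrite -(@normr0 _ V).
  by apply: cvg_norm; apply/subr_cvg0.
Qed.

End SymmetricForm.

(** * Weak limits in a Hilbert space *)

Section WeakLimits.
Variables (R : realType) (H : completeNormedModType R) (ip : {dot H for idfun}).
Hypothesis hilb : induces_norm ip.

Lemma riesz_on_subspace (D : set H) (F : H -> R) (C : R) :
  linear_subspace D ->
  (forall (a : R) (u v : H), D u -> D v -> F (a *: u + v) = a * F u + F v) ->
  (forall u, D u -> `|F u| <= C * `|u|) ->
  exists p, forall w, D w -> F w = ip p w.
Proof.
move=> Dsub Flin FC.
have [||u _|u [p [Du up uF]]] :=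
  @form_minimizing_sequence _ _ D ip F 1 C Dsub _ _ ltr01 _ Flin FC.
- by move=> a u v z _ _ _; rewrite !ipE.
- by move=> u v _ _; rewrite ipC.
- by rewrite mul1r hilb.
exists p => w Dw; apply: cvg_unique (uF _ Dw) _; first exact: Rhausdorff.
by apply: cvg_ip => //; exact: cvg_cst.
Qed.

Definition weakly (x : nat -> H) (l : H) : Prop :=
  forall w, ip (x n) w @[n --> \oo] --> ip l w.

Lemma cvg_weakly (x : nat -> H) (l : H) : x @ \oo --> l -> weakly x l.
Proof. by move=> xl w; apply: cvg_ip => //; exact: cvg_cst. Qed.

Lemma weaklyD (x y : nat -> H) (k l : H) : weakly x k -> weakly y l ->
  weakly (fun n => x n + y n) (k + l).
Proof.
by move=> xk yl w; rewrite ipDl; under eq_cvg do rewrite ipDl; exact: cvgD.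
Qed.

Lemma weaklyZ (a : R) (x : nat -> H) (l : H) : weakly x l ->
  weakly (fun n => a *: x n) (a *: l).
Proof.
by move=> xl w; rewrite ipZl; under eq_cvg do rewrite ipZl; exact: cvgMr.
Qed.

Lemma cvg_ip_weakly_strongly (x y : nat -> H) (l k : H) (C : R) :
  weakly x l -> (forall n, `|x n| <= C) -> y @ \oo --> k ->
  ip (x n) (y n) @[n --> \oo] --> ip l k.
Proof.
move=> xl xC yk.
have E n : ip (x n) (y n) = ip (x n) k + ip (x n) (y n - k).
  by rewrite !ipE; ring.
under eq_cvg do rewrite E.
rewrite -[ip l k]addr0; apply: cvgD; first exact: xl.
apply: norm_cvg0.
apply: (@squeeze_cvgr _ _ _ _ (fun=> 0) (fun n => C * `|y n - k|)).
- apply: nearW => n; rewrite normr_ge0/=.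
  by rewrite (le_trans (cauchy_schwarz_norm hilb _ _))// ler_wpM2r.
- exact: cvg_cst.
- rewrite -(mulr0 C); apply: cvgMr; rewrite -(@normr0 _ H).
  by apply: cvg_norm; apply/subr_cvg0.
Qed.

(** Boundedness makes the functionals [ip (x n)] equicontinuous, so that their
    convergence propagates from a dense set. *)
Lemma weakly_of_dense (D : set H) (x : nat -> H) (l : H) (C : R) :
  dense D -> (forall n, `|x n| <= C) ->
  (forall w, D w -> ip (x n) w @[n --> \oo] --> ip l w) -> weakly x l.
Proof.
move=> Ddense xC xD w; apply/cvgrPdist_lt => e e0.
have K0 : 0 < `|l| + C + 1.
  by have := le_trans (normr_ge0 _) (xC 0%N); have := normr_ge0 l; lra.
have r0 : 0 < e / 2 / (`|l| + C + 1) by rewrite !divr_gt0.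
have [||d [+ Dd]] := Ddense (ball w (e / 2 / (`|l| + C + 1))).
- by exists w; exact: ballxx.
- exact: ball_open.
rewrite -ball_normE /= ltr_pdivlMr// => wd.
have e20 : 0 < e / 2 by rewrite divr_gt0.
have /cvgrPdist_lt/(_ _ e20) xd := xD _ Dd.
near=> n.
have E : ip l w - ip (x n) w = ip l d - ip (x n) d + ip (l - x n) (w - d).
  by rewrite !ipE; ring.
rewrite E (le_lt_trans (ler_normD _ _))// [ltRHS]splitr ltrD//.
  by near: n.
apply: le_lt_trans wd; apply: le_trans (cauchy_schwarz_norm hilb _ _) _.
rewrite mulrC ler_wpM2l//.
by rewrite (le_trans (ler_normB _ _))// -addrA lerD2l (le_trans (xC n))// lerDl.
Unshelve. all: by end_near. Qed.

Lemma selfadjoint_sym (A : operator H) : selfadjoint ip A ->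
  forall u v, dom A u -> dom A v -> ip (A u) v = ip u (A v).
Proof.
move=> [_ AE] u v Au Av.
have : graph A (v, A v) by [].
by rewrite -AE => /(_ u Au).
Qed.

(** The functional w |-> (A w, l) is the limit of w |-> (w, A (x n)), hence
    bounded by C on the dense domain of A, and Riesz represents it by some p.
    Thus (l, p) is in the graph of the adjoint, which is the graph of A. *)
Lemma selfadjoint_weak_limit (A : operator H) (x : nat -> H) (l : H) (C : R) :
  linear_operator A -> selfadjoint ip A ->
  (forall n, dom A (x n)) -> (forall n, `|A (x n)| <= C) -> x @ \oo --> l ->
  dom A l /\ weakly (fun n => A (x n)) (A l).
Proof.
move=> [Dsub Alin] Asa Ax AC xl.
have Asym := selfadjoint_sym Asa.
have lim w : dom A w -> ip (A (x n)) w @[n --> \oo] --> ip (A w) l.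
  move=> Aw; under eq_cvg do rewrite Asym// ipC.
  by apply: cvg_ip => //; exact: cvg_cst.
have [||p pP] := @riesz_on_subspace (dom A) (fun w => ip (A w) l) C Dsub.
- by move=> a u v Au Av; rewrite Alin// !ipE.
- move=> w Aw; apply: (ler_cvg_to (cvg_norm (lim _ Aw)) (cvg_cst _)).
  apply: nearW => n.
  by rewrite (le_trans (cauchy_schwarz_norm hilb _ _))// ler_wpM2r.
have : adjoint_graph ip A (l, p) by move=> w Aw /=; rewrite pP// ipC.
rewrite Asa.2 => -[/= Al pE]; split=> //; rewrite -pE.
by apply: (weakly_of_dense Asa.1 AC) => w Aw; rewrite -pP//; exact: lim.
Qed.

End WeakLimits.

(** * Maximal monotone operators: Minty's theorem and the resolvent *)

Section Minty.
Variables (R : realType) (H : completeNormedModType R) (ip : {dot H for idfun}).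
Hypothesis hilb : induces_norm ip.

(** The epigraph of the Fitzpatrick function of G, that is of
    (x, y) |-> sup_((a, b) in G) (x, b) + (a, y) - (a, b).  Working with the
    epigraph avoids the value +oo. *)
Let epigraph (G : set (H * H)) : set (H * H * R) :=
  [set p | forall q, G q ->
     ip p.1.1 q.2 + ip q.1 p.1.2 - ip q.1 q.2 <= p.2].

(** The variational proof of Simons and Zalinescu. Maximality of G says that
    the Fitzpatrick function F satisfies F (x, y) >= (x, y), so that
    F + (|x|^2 + |y|^2) / 2 is bounded below by 0; it is uniformly convex and has a
    minimiser (x, y). The optimality condition at the points of G shows that
    (- y, - x) is monotonically related to G, hence in G; applied to (- y, - x)
    itself, it gives |x + y|^2 <= 0. So y = - x and (x, - x) is in G. *)
Lemma minty_graph (G : set (H * H)) :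
  G !=set0 -> monotone_graph ip G ->
  (forall p, (forall q, G q -> 0 <= ip (p.2 - q.2) (p.1 - q.1)) -> G p) ->
  exists u, G (u, - u).
Proof.
move=> [q0 Gq0] Gmon Gmax.
pose J (p : H * H * R) := p.2 + 2^-1 * (`|p.1.1| ^+ 2 + `|p.1.2| ^+ 2).
have epi_mon q : G q -> epigraph G (q, ip q.1 q.2).
  move=> Gq r Gr /=; have := Gmon _ _ Gq Gr.
  by rewrite !ipE (ipC ip q.1 q.2) (ipC ip q.1 r.2) (ipC ip r.1 q.2)
     (ipC ip r.1 r.2); lra.
have epi_ge p : epigraph G p -> ip p.1.1 p.1.2 <= p.2.
  move=> Ep; rewrite leNgt; apply/negP => lt_p.
  have Gp : G p.1.
    apply: Gmax => r Gr; have := Ep _ Gr.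
    by rewrite !ipE (ipC ip p.1.2 p.1.1) (ipC ip p.1.1 r.2) (ipC ip r.1 p.1.2)
       (ipC ip r.1 r.2); lra.
  by have := Ep _ Gp; rewrite addrK leNgt lt_p.
have J_ge0 p : epigraph G p -> 0 <= J p.
  move=> /epi_ge; rewrite /J; have := ip_ge0 hilb (p.1.1 + p.1.2).
  by rewrite -hilb (sqr_normD hilb); lra.
have [|m [p [m_le Ep Jp]]] := minimizing_sequence _ J_ge0.
  by exists (q0, ip q0.1 q0.2); exact: epi_mon.
have convex (t : R) a b : 0 <= t -> t <= 1 -> epigraph G a -> epigraph G b ->
    epigraph G (t *: (b.1.1 - a.1.1) + a.1.1, t *: (b.1.2 - a.1.2) + a.1.2,
                t * (b.2 - a.2) + a.2).
  move=> t0 t1 Ea Eb q Gq /=; have := Ea _ Gq; have := Eb _ Gq.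
  by rewrite !ipE; nra.
have half_dist i j :
    `|(p i).1.1 - (p j).1.1| ^+ 2 + `|(p i).1.2 - (p j).1.2| ^+ 2
    <= 4 * (harmonic i + harmonic j).
  have h0 : (0 : R) <= 2^-1 by rewrite invr_ge0.
  have h1 : (2^-1 : R) <= 1 by rewrite invf_le1// ler1n.
  have := m_le _ (convex _ _ _ h0 h1 (Ep j) (Ep i)).
  have := Jp i; have := Jp j; rewrite /J.
  move: (harmonic i) (harmonic j) => e e' /=.
  rewrite !hilb !ipE (ipC ip (p j).1.1 (p i).1.1) (ipC ip (p j).1.2 (p i).1.2).
  by lra.
have /cvg_ex[x px] : cvgn (fun n => (p n).1.1).
  apply: (@cvg_of_sqr_dist _ _ _ 4) => i j; apply: le_trans (half_dist i j).
  by rewrite lerDl sqr_ge0.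
have /cvg_ex[y py] : cvgn (fun n => (p n).1.2).
  apply: (@cvg_of_sqr_dist _ _ _ 4) => i j; apply: le_trans (half_dist i j).
  by rewrite lerDr sqr_ge0.
(* the value of the third coordinate for which J equals the infimum m *)
pose t := m - 2^-1 * (`|x| ^+ 2 + `|y| ^+ 2).
have Et : epigraph G (x, y, t).
  move=> q Gq /=.
  have lhs : ip (p n).1.1 q.2 + ip q.1 (p n).1.2 - ip q.1 q.2 @[n --> \oo]
      --> ip x q.2 + ip q.1 y - ip q.1 q.2.
    apply: cvgB; last exact: cvg_cst.
    by apply: cvgD; apply: cvg_ip => //; exact: cvg_cst.
  have rhs : m + harmonic n - 2^-1 * (ip (p n).1.1 (p n).1.1
      + ip (p n).1.2 (p n).1.2) @[n --> \oo] --> t.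
    rewrite /t !hilb; apply: cvgB.
      rewrite -[m in _ --> m]addr0; apply: cvgD; first exact: cvg_cst.
      exact: cvg_harmonic.
    by apply: cvgMr; apply: cvgD; exact: cvg_ip.
  apply: (ler_cvg_to lhs rhs); apply: nearW => n.
  by have := Ep n _ Gq; have := Jp n; rewrite /J !hilb; lra.
(* first-order optimality of (x, y, t) in the direction of a point of G *)
have opt q : G q ->
    t + `|x| ^+ 2 + `|y| ^+ 2 <= ip q.1 q.2 + ip x q.1 + ip y q.2.
  move=> Gq; rewrite -subr_ge0.
  set D := `|q.1 - x| ^+ 2 + `|q.2 - y| ^+ 2.
  have D0 : 0 <= D by rewrite addr_ge0// sqr_ge0.
  set d := _ - _.
  have key s : 0 < s -> s <= 1 -> 0 <= d + s * (2^-1 * D).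
    move=> s0 s1.
    have := m_le _ (convex s _ _ (ltW s0) s1 Et (epi_mon _ Gq)).
    have -> : m = t + 2^-1 * (`|x| ^+ 2 + `|y| ^+ 2) by rewrite /t subrK.
    rewrite /J /= => h; rewrite -(pmulr_rge0 _ s0).
    move: h; rewrite -subr_ge0; congr (0 <= _); rewrite /d /D !hilb !ipE.
    by rewrite (ipC ip q.1 x) (ipC ip q.2 y); field.
  rewrite leNgt; apply/negP => d0.
  have K0 : 0 < 2^-1 * D - d by lra.
  have := key (- d / (2^-1 * D - d)); rewrite divr_gt0 ?oppr_gt0// => /(_ isT).
  rewrite ler_pdivrMr// mul1r lerDr mulr_ge0// ?invr_ge0// => /(_ isT).
  have -> : d + - d / (2^-1 * D - d) * (2^-1 * D) = - (d ^+ 2 / (2^-1 * D - d)).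
    by field; rewrite gt_eqF//; lra.
  by rewrite oppr_ge0 leNgt divr_gt0// exprn_even_gt0//= lt_eqF.
pose z := (- y, - x).
have sq0 : 0 <= ip (x + y) (x + y) by exact: ip_ge0.
have xyt := epi_ge _ Et; rewrite /= in xyt.
have Gz : G z.
  apply: Gmax => q /opt; rewrite /z/= !hilb !ipE.
  rewrite (ipC ip q.2 q.1) (ipC ip q.2 y) (ipC ip x q.1) (ipC ip x y).
  by move: sq0 xyt; rewrite !ipE (ipC ip x y); lra.
have := opt _ Gz; rewrite /z /= !hilb !ipE => h.
have : `|x + y| ^+ 2 = 0.
  apply/eqP; rewrite eq_le hilb sq0 andbT.
  by move: h xyt; rewrite !ipE (ipC ip y x); lra.
move=> /eqP; rewrite sqrf_eq0 normr_eq0 addr_eq0 => /eqP xy.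
by exists x; rewrite {2}xy opprK; move: Gz; rewrite /z xy opprK.
Qed.

End Minty.

Section Resolvent.
Variables (R : realType) (H : completeNormedModType R) (ip : {dot H for idfun}).
Hypothesis hilb : induces_norm ip.
Variables (A : operator H) (lam : R).
Hypothesis A_maxmon : maximal_monotone ip A.
Hypothesis lam_gt0 : 0 < lam.

Lemma monotone_operator u v : dom A u -> dom A v ->
  0 <= ip (A u - A v) (u - v).
Proof. by move=> Au Av; apply: (A_maxmon.1 (u, A u) (v, A v)). Qed.

(** Maximality in the form in which it is used: adding a monotonically related
    point to the graph leaves it monotone. *)
Lemma maximal_monotone_related (u y : H) :
  (forall v, dom A v -> 0 <= ip (y - A v) (u - v)) -> dom A u /\ y = A u.
Proof.
move=> rel.
apply: (A_maxmon.2 (graph A `|` [set (u, y)]) _ _ (u, y)); last by right.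
- move=> p q [Ap|->] [Aq|->].
  + exact: A_maxmon.1.
  + move: Ap; rewrite /graph /= => -[Ap ->].
    by rewrite -opprB -[p.1 - u]opprB !ipE; have := rel _ Ap; rewrite !ipE; lra.
  + by move: Aq; rewrite /graph /= => -[Aq ->]; exact: rel.
  + by rewrite subrr ip0l.
- by move=> p; left.
Qed.

(** Minty's theorem for the graph of u |-> lam A u - x, which is again maximal
    monotone. *)
Lemma resolventP x :
  dom A (resolvent A lam x)
  /\ resolvent A lam x + lam *: A (resolvent A lam x) = x.
Proof.
suff [u []] : exists u, dom A u /\ u + lam *: A u = x.
  move=> Au uE.
  by apply: (@getPex _ [set u | dom A u /\ u + lam *: A u = x]); exists u.
have [u0 Au0] : dom A !=set0.
  have [//|ne] := pselect (dom A !=set0).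
  have [|A0 _] := @maximal_monotone_related 0 0; last by exists 0.
  by move=> v Av; case: ne; exists v.
have [||p rel|u [/= Au uE]] := @minty_graph R H ip hilb
  [set p | dom A p.1 /\ p.2 = lam *: A p.1 - x].
- by exists (u0, lam *: A u0 - x).
- move=> p q [/= Ap ->] [/= Aq ->].
  rewrite opprB addrA subrK -scalerBr ipZl mulr_ge0 ?(ltW lam_gt0)//.
  exact: monotone_operator.
- have [|Ap pE] := @maximal_monotone_related p.1 (lam^-1 *: (p.2 + x)).
  + move=> v Av; have := rel (v, lam *: A v - x) (conj Av erefl).
    rewrite /= -(pmulr_rge0 (ip (_ *: _ - _) _) lam_gt0); congr (0 <= _).
    by rewrite !ipE; field; rewrite gt_eqF.
  + split=> //; rewrite -pE scalerA divff ?gt_eqF// scale1r addrK//.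
- by exists u; split=> //; rewrite -[RHS](subKr (lam *: A u)) -uE opprK addrC.
Qed.

Lemma yosidaE x : yosida A lam x = A (resolvent A lam x).
Proof.
rewrite /yosida -[x in x - _](resolventP x).2 addrC addKr.
by rewrite scalerA mulVf ?gt_eqF// scale1r.
Qed.

(** Splitting x into its resolvent and Yosida parts reduces all the estimates
    below to the monotonicity of A at the pair of resolvents. *)
Lemma yosida_decomposition x : x = resolvent A lam x + lam *: yosida A lam x.
Proof. by rewrite yosidaE (resolventP x).2. Qed.

Let decompositionB x y : x - y =
  (resolvent A lam x - resolvent A lam y)
  + lam *: (yosida A lam x - yosida A lam y).
Proof.
by rewrite scalerBr addrACA -opprD -!yosida_decomposition.
Qed.

Let monotone_pair x y :
  0 <= ip (yosida A lam x - yosida A lam y)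
          (resolvent A lam x - resolvent A lam y).
Proof.
by rewrite !yosidaE; apply: monotone_operator; exact: (resolventP _).1.
Qed.

Lemma yosida_cocoercive x y :
  lam * `|yosida A lam x - yosida A lam y| ^+ 2
  <= ip (yosida A lam x - yosida A lam y) (x - y).
Proof.
rewrite hilb (decompositionB x y); move: (monotone_pair x y).
move: (yosida A lam x - _) (resolvent A lam x - _) => dY dJ.
by rewrite ipDr ipZr lerDr.
Qed.

Lemma yosida_monotone x y :
  0 <= ip (yosida A lam x - yosida A lam y) (x - y).
Proof.
apply: le_trans (yosida_cocoercive x y).
by rewrite mulr_ge0 ?sqr_ge0// ltW.
Qed.

Lemma yosida_lipschitz x y :
  `|yosida A lam x - yosida A lam y| <= lam^-1 * `|x - y|.
Proof.
apply: le_of_sqr => //; apply: le_trans (yosida_cocoercive x y) _.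
by rewrite mulrC; exact: cauchy_schwarz.
Qed.

Lemma resolvent_firm x y :
  `|resolvent A lam x - resolvent A lam y| ^+ 2
  <= ip (resolvent A lam x - resolvent A lam y) (x - y).
Proof.
rewrite hilb (decompositionB x y); move: (monotone_pair x y).
move: (yosida A lam x - _) (resolvent A lam x - _) => dY dJ.
by rewrite ipC ipDr ipZr lerDl => dYJ; rewrite mulr_ge0// ltW.
Qed.

Lemma resolvent_nonexpansive x y :
  `|resolvent A lam x - resolvent A lam y| <= `|x - y|.
Proof.
rewrite -[leRHS]mul1r -invr1; apply: le_of_sqr => //; rewrite mul1r.
apply: le_trans (resolvent_firm x y) _.
by rewrite mulrC; exact: cauchy_schwarz.
Qed.

End Resolvent.

(** The estimate behind the Cauchy property of Yosida regularisations: in x - y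
    = (J x - J y) + (lam u - mu v), with u and v the Yosida parts, the first
    bracket pairs nonnegatively with u - v and the second one is small. *)
Lemma yosida_almost_monotone (R : realType) (H : completeNormedModType R)
    (ip : {dot H for idfun}) (A : operator H) (lam mu C : R) (x y : H) :
  induces_norm ip -> maximal_monotone ip A -> 0 < lam -> 0 < mu ->
  `|yosida A lam x| <= C -> `|yosida A mu y| <= C ->
  - (2 * C ^+ 2 * (lam + mu))
  <= ip (yosida A lam x - yosida A mu y) (x - y).
Proof.
move=> hilb Amm lam0 mu0.
have : 0 <= ip (yosida A lam x - yosida A mu y)
               (resolvent A lam x - resolvent A mu y).
  rewrite (yosidaE hilb Amm lam0) (yosidaE hilb Amm mu0).
  apply: (monotone_operator Amm).
    exact: (resolventP hilb Amm lam0 x).1.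
  exact: (resolventP hilb Amm mu0 y).1.
have := yosida_decomposition hilb Amm lam0 x.
have := yosida_decomposition hilb Amm mu0 y.
move: (yosida A lam x) (yosida A mu y) (resolvent A lam x) (resolvent A mu y).
move=> u v j k -> -> mon uC vC.
have -> : j + lam *: u - (k + mu *: v) = (j - k) + (lam *: u - mu *: v).
  by rewrite opprD addrACA.
rewrite ipDr; apply: le_trans (_ : ip (u - v) (lam *: u - mu *: v) <= _);
  last by rewrite lerDr.
rewrite lerNl; apply: le_trans (_ : `|u - v| * `|lam *: u - mu *: v| <= _).
  rewrite -ipNl -(normrN (u - v)); exact: cauchy_schwarz.
have C0 : 0 <= C by exact: le_trans uC.
have -> : 2 * C ^+ 2 * (lam + mu) = (C + C) * (lam * C + mu * C) by ring.
apply: ler_pM => //; rewrite (le_trans (ler_normB _ _))//; apply: lerD => //.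
  by rewrite normrZ (gtr0_norm lam0) ler_pM2l.
by rewrite normrZ (gtr0_norm mu0) ler_pM2l.
Qed.

Lemma linear_operatorB (R : realType) (H : completeNormedModType R)
    (A : operator H) (u v : H) : linear_operator A -> dom A u -> dom A v ->
  dom A (u - v) /\ A (u - v) = A u - A v.
Proof.
move=> [Asub Alin] Au Av.
have -> : u - v = -1 *: v + u by rewrite scaleN1r addrC.
by split; [exact: Asub.2|rewrite Alin// scaleN1r addrC].
Qed.

Lemma linear_monotone_ge0 (R : realType) (H : completeNormedModType R)
    (ip : {dot H for idfun}) (A : operator H) (u : H) :
  linear_operator A -> maximal_monotone ip A -> dom A u -> 0 <= ip (A u) u.
Proof.
move=> Alin Amm Au; have [A0 E] := linear_operatorB Alin Au Au.
move: A0 E; rewrite !subrr => A0 E.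
by have := monotone_operator Amm Au A0; rewrite E !subr0.
Qed.

(** * Vanishing Yosida regularisation *)

(** Throughout, N gathers the everywhere defined part of the equation. *)
Section VanishingYosida.
Variables (R : realType) (H : completeNormedModType R) (ip : {dot H for idfun}).
Variables (N : H -> H) (B A Phi : operator H) (c K a b k : R).
Hypothesis hilb : induces_norm ip.
Hypotheses (c_gt0 : 0 < c) (K_ge0 : 0 <= K).
Hypotheses (a_gt0 : 0 < a) (b_gt0 : 0 < b) (k_gt0 : 0 < k).
Hypothesis N_mon : forall x y, c * `|x - y| ^+ 2 <= ip (N x - N y) (x - y).
Hypothesis N_lip : forall x y, `|N x - N y| <= K * `|x - y|.
Hypotheses (B_lin : linear_operator B) (B_mm : maximal_monotone ip B).
Hypothesis B_sa : selfadjoint ip B.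
Hypotheses (A_lin : linear_operator A) (A_mm : maximal_monotone ip A).
Hypothesis A_sa : selfadjoint ip A.
Hypothesis BA_ge0 : forall w, (dom B `&` dom A) w -> 0 <= ip (B w) (A w).
Hypothesis Phi_mm : maximal_monotone ip Phi.
Hypothesis Phi_angle : forall lam : R, 0 < lam ->
  [/\ yosida Phi lam 0 = 0,
      forall w, dom B w -> 0 <= ip (yosida Phi lam w) (B w)
    & forall w, dom A w -> 0 <= ip (yosida Phi lam w) (A w)].

Let regularized (lam : R) (x : H) : Prop :=
  (dom B `&` dom A) x
  /\ N x + a *: B x + b *: A x + k *: yosida Phi lam x = 0.

Let tested lam x w : regularized lam x ->
  ip (N x) w + a * ip (B x) w + b * ip (A x) w
    + k * ip (yosida Phi lam x) w = 0.
Proof.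
move=> [_]; move: (yosida Phi lam x) => y E.
by rewrite -!ipZl -!ipDl E ip0l.
Qed.

(** Testing with x bounds x, hence N x. Testing with B x and A x, all other
    terms are nonnegative, which bounds B x and A x; the equation then bounds
    the Yosida term. *)
Let apriori lam x : 0 < lam -> regularized lam x ->
  let C := `|N 0| + K * (c^-1 * `|N 0|) in
  [/\ `|B x| <= a^-1 * C, `|A x| <= b^-1 * C
    & `|yosida Phi lam x| <= k^-1 * (3 * C)].
Proof.
move=> lam0 reg C; have [[Bx Ax] E] := reg.
have [Y0 YB YA] := Phi_angle lam0.
have Yx : 0 <= ip (yosida Phi lam x) x.
  by have := yosida_monotone hilb Phi_mm lam0 x 0; rewrite Y0 !subr0.
have BA := BA_ge0 (conj Bx Ax).
have BAs : ip (A x) (B x) = ip (B x) (A x) by rewrite ipC.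
have B0 := linear_monotone_ge0 B_lin B_mm Bx.
have A0 := linear_monotone_ge0 A_lin A_mm Ax.
have xr : `|x| <= c^-1 * `|N 0|.
  apply: le_of_sqr => //.
  have := N_mon x 0; rewrite subr0 => h; apply: le_trans h _.
  have := tested x reg.
  have := cauchy_schwarz hilb (- N 0) x; rewrite normrN ipDl ipNl.
  have := mulr_ge0 (ltW a_gt0) B0; have := mulr_ge0 (ltW b_gt0) A0.
  have := mulr_ge0 (ltW k_gt0) Yx; lra.
have NC : `|N x| <= C.
  rewrite -(subrK (N 0) (N x)) addrC (le_trans (ler_normD _ _))// lerD2l.
  by rewrite (le_trans (N_lip _ _))// subr0 ler_wpM2l.
have C0 : 0 <= C by exact: le_trans NC.
have test w : - ip (N x) w <= C * `|w|.
  rewrite -ipNl (le_trans (cauchy_schwarz hilb _ _))// normrN.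
  by rewrite ler_wpM2r.
have BC : `|B x| <= a^-1 * C.
  apply: le_of_sqr => //; rewrite hilb; have := tested (B x) reg.
  have := mulr_ge0 (ltW b_gt0) BA; have := mulr_ge0 (ltW k_gt0) (YB _ Bx).
  by have := test (B x); rewrite BAs; lra.
have AC : `|A x| <= b^-1 * C.
  apply: le_of_sqr => //; rewrite hilb; have := tested (A x) reg.
  have := mulr_ge0 (ltW a_gt0) BA; have := mulr_ge0 (ltW k_gt0) (YA _ Ax).
  by have := test (A x); lra.
split=> //.
rewrite ler_pdivlMl// -(gtr0_norm k_gt0) -normrZ.
move/eqP: E; rewrite addrC addr_eq0 => /eqP ->; rewrite normrN.
rewrite (le_trans (ler_normD _ _))//.
rewrite (le_trans (lerD (ler_normD _ _) (lexx _)))//.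
rewrite !normrZ (gtr0_norm a_gt0) (gtr0_norm b_gt0).
by move: BC AC; rewrite !ler_pdivlMl//; lra.
Qed.

Let almost_unique lam mu x y (C : R) : 0 < lam -> 0 < mu ->
  regularized lam x -> regularized mu y ->
  `|yosida Phi lam x| <= C -> `|yosida Phi mu y| <= C ->
  `|x - y| ^+ 2 <= c^-1 * (k * (2 * C ^+ 2)) * (lam + mu).
Proof.
move=> lam0 mu0 regx regy xC yC.
rewrite -!mulrA ler_pdivlMl//; apply: le_trans (N_mon x y) _.
have [[[Bx Ax] _] [[By Ay] _]] := (regx, regy).
have := yosida_almost_monotone hilb Phi_mm lam0 mu0 xC yC.
have := monotone_operator B_mm Bx By; have := monotone_operator A_mm Ax Ay.
have := tested (x - y) regx; have := tested (x - y) regy.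
move: (yosida Phi lam x) (yosida Phi mu y) (x - y) => u v w.
rewrite !(ipDl, ipNl) => ty tx.
move=> /(mulr_ge0 (ltW b_gt0)) mA /(mulr_ge0 (ltW a_gt0)) mB.
rewrite lerNl => /(ler_wpM2l (ltW k_gt0)) mP.
by lra.
Qed.

(** Along lam = 1/(n+1), the regularised solutions converge strongly by
    [almost_unique], B x, A x and the Yosida terms converge weakly by [apriori],
    and the resolvents of Phi have the same strong limit as the solutions.  A
    product of a weak and a strong limit passes to the limit in the monotonicity
    inequality of Phi, and maximality identifies the weak limit with Phi l. *)
Lemma vanishing_yosida :
  (forall lam : R, 0 < lam -> exists x, regularized lam x) ->
  exists x, [/\ (dom B `&` dom A) x, dom Phi x
              & N x + a *: B x + b *: A x + k *: Phi x = 0].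
Proof.
move=> solvable.
have lam0 n : (0 : R) < harmonic n := harmonic_gt0 n.
have [x reg] := choice (fun n => solvable _ (lam0 n)).
pose C := `|N 0| + K * (c^-1 * `|N 0|).
have BC n : `|B (x n)| <= a^-1 * C by case: (apriori (lam0 n) (reg n)).
have AC n : `|A (x n)| <= b^-1 * C by case: (apriori (lam0 n) (reg n)).
pose y n := yosida Phi (harmonic n) (x n).
have yC n : `|y n| <= k^-1 * (3 * C) by case: (apriori (lam0 n) (reg n)).
have /cvg_ex[l xl] : cvgn x.
  apply: cvg_of_sqr_dist => i j.
  exact: almost_unique (lam0 i) (lam0 j) (reg i) (reg j) (yC i) (yC j).
have [Bl Bw] := selfadjoint_weak_limit hilb B_lin B_sa
  (fun n => (reg n).1.1) BC xl.
have [Al Aw] := selfadjoint_weak_limit hilb A_lin A_sa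
  (fun n => (reg n).1.2) AC xl.
have Nw : weakly ip (fun n => N (x n)) (N l).
  apply: cvg_weakly => //; apply/subr_cvg0; apply: norm_cvg0.
  apply: (@squeeze_cvgr _ _ _ _ (fun=> 0) (fun n => K * `|x n - l|)).
  - by apply: nearW => n; rewrite normr_ge0/=.
  - exact: cvg_cst.
  - rewrite -(mulr0 K); apply: cvgMr; rewrite -(@normr0 _ H).
    by apply: cvg_norm; apply/subr_cvg0.
pose z := (- k^-1) *: (N l + a *: B l + b *: A l).
have yE n : y n = (- k^-1) *: (N (x n) + a *: B (x n) + b *: A (x n)).
  have := (reg n).2; rewrite -/(y n) => /eqP; rewrite addr_eq0 => /eqP ->.
  by rewrite scaleNr scalerN opprK scalerA mulVf ?scale1r// gt_eqF.
have yw : weakly ip y z.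
  rewrite (funext yE); apply: weaklyZ; apply: weaklyD; last exact: weaklyZ.
  by apply: weaklyD => //; exact: weaklyZ.
pose j n := resolvent Phi (harmonic n) (x n).
have jl : j @ \oo --> l.
  have jE n : j n = x n - harmonic n *: y n.
    by rewrite [X in X - _](yosida_decomposition hilb Phi_mm (lam0 n)) addrK.
  rewrite (funext jE) -[l]subr0; apply: cvgB => //; apply: norm_cvg0.
  apply: (@squeeze_cvgr _ _ _ _ (fun=> 0)
    (fun n => harmonic n * (k^-1 * (3 * C)))).
  - apply: nearW => n; rewrite normr_ge0/= normrZ (gtr0_norm (lam0 n)).
    by rewrite ler_wpM2l// ltW.
  - exact: cvg_cst.
  - by rewrite -(mul0r (k^-1 * (3 * C))); apply: cvgMl; exact: cvg_harmonic.
have [Pl zE] : dom Phi l /\ z = Phi l.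
  apply: (maximal_monotone_related Phi_mm) => v Pv.
  have lim : ip (y n - Phi v) (j n - v) @[n --> \oo] --> ip (z - Phi v) (l - v).
    apply: (@cvg_ip_weakly_strongly _ _ _ hilb _ _ _ _
      (k^-1 * (3 * C) + `|Phi v|)).
    - by apply: weaklyD => //; apply: cvg_weakly => //; exact: cvg_cst.
    - by move=> n; rewrite (le_trans (ler_normB _ _))// lerD2r.
    - by apply: cvgB => //; exact: cvg_cst.
  apply: (ler_cvg_to (cvg_cst 0) lim); apply: nearW => n.
  rewrite /y (yosidaE hilb Phi_mm (lam0 n)).
  apply: (monotone_operator Phi_mm) => //.
  exact: (resolventP hilb Phi_mm (lam0 n) (x n)).1.
exists l; split=> //.
by rewrite -zE /z scalerA mulrN divff ?gt_eqF// scaleN1r subrr.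
Qed.

End VanishingYosida.

(** * A semilinear variational equation *)

Lemma contraction_fixpoint (R : realType) (H : completeNormedModType R)
    (f : H -> H) (q : R) : 0 <= q -> q < 1 ->
  (forall x y, `|f x - f y| <= q * `|x - y|) -> exists x, f x = x.
Proof.
move=> q0 q1 fq.
have [|||x _ /esym] := @banach_fixed_point R H setT ('totalfun_setT f).
- by exists (NngNum q0); split=> //= -[x y] _; exact: fq.
- exact: closedT.
- by exists 0.
by exists x.
Qed.

Lemma continuous_linear_bound (R : realType) (V H : normedModType R)
    (f : {linear V -> H}) : continuous f ->
  exists2 C : R, 0 <= C & forall u, `|f u| <= C * `|u|.
Proof.
move=> /linear_bounded_continuous/linear_boundedP/pinfty_ex_gt0[C C0 fC].
by exists C => //; exact: ltW.
Qed.

Section SemilinearEquation.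
Variables (R : realType) (V H : completeNormedModType R).
Variables (ip : {dot H for idfun}) (inc : {linear V -> H}) (W : set V).
Variables (S : V -> V -> R) (Q : H -> H) (om M gam ep ell : R).
Hypothesis hilb : induces_norm ip.
Hypothesis inc_cont : continuous inc.
Hypotheses (W_sub : linear_subspace W) (W_closed : closed W).
Hypothesis S_lin : forall (t : R) (u v z : V), W u -> W v -> W z ->
  S (t *: u + v) z = t * S u z + S v z.
Hypothesis S_sym : forall u v, W u -> W v -> S u v = S v u.
Hypothesis S_bounded : forall u v, W u -> W v -> `|S u v| <= M * `|u| * `|v|.
Hypothesis om_gt0 : 0 < om.
Hypothesis S_coercive : forall u, W u ->
  om * `|u| ^+ 2 + gam * `|inc u| ^+ 2 <= S u u.
Hypotheses (ep_ge0 : 0 <= ep) (ep_lt : ep < gam).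
Hypothesis Q_mon : forall x y,
  - (ep * `|x - y| ^+ 2) <= ip (Q x - Q y) (x - y).
Hypothesis Q_lip : forall x y, `|Q x - Q y| <= ell * `|x - y|.

(** The damping: since ell^2 = kap (gam - ep), the factor
    (kap^2 + 2 kap ep + ell^2) / (gam + kap)^2 of the iteration in
    [semilinear_solvable] is less than 1. *)
Let kap := ell ^+ 2 / (gam - ep).

Let gam_gt0 : 0 < gam. Proof. exact: le_lt_trans ep_lt. Qed.
Let gap : 0 < gam - ep. Proof. by rewrite subr_gt0. Qed.
Let kap_ge0 : 0 <= kap.
Proof. by rewrite divr_ge0 ?sqr_ge0// ltW. Qed.

(** Lax-Milgram for the form with the added term kap (inc u, inc z). *)
Let damped_solution (w : H) : exists u, W u /\
  forall z, W z -> S u z + kap * ip (inc u) (inc z) = ip w (inc z).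
Proof.
have [Ci Ci0 incC] := continuous_linear_bound inc_cont.
have [||||||u Wu uP] := @lax_milgram R V W
  (fun u z => S u z + kap * ip (inc u) (inc z)) (fun z => ip w (inc z))
  om (`|w| * Ci) W_sub _ _ om_gt0 _ _ _ (M + kap * Ci * Ci) W_closed.
- move=> t u v z Wu Wv Wz /=.
  by rewrite S_lin// linearP ipDl ipZl; ring.
- by move=> u v Wu Wv /=; rewrite S_sym// ipC.
- move=> u Wu /=; rewrite -hilb; apply: le_trans (_ : S u u <= _).
    apply: le_trans (S_coercive Wu); rewrite lerDl.
    by rewrite mulr_ge0 ?sqr_ge0// ltW.
  by rewrite lerDl mulr_ge0// sqr_ge0.
- by move=> t u v Wu Wv /=; rewrite linearP ipDr ipZr.
- move=> u Wu /=; rewrite (le_trans (cauchy_schwarz_norm hilb _ _))//.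
  by rewrite -mulrA ler_wpM2l.
- move=> u v Wu Wv /=; apply: le_trans (ler_normD _ _) _.
  have -> : (M + kap * Ci * Ci) * `|u| * `|v| =
      M * `|u| * `|v| + kap * ((Ci * `|u|) * (Ci * `|v|)) by ring.
  apply: lerD; first exact: S_bounded.
  rewrite normrM (ger0_norm kap_ge0) ler_wpM2l//.
  by apply: le_trans (cauchy_schwarz_norm hilb _ _) _; exact: ler_pM.
by exists u.
Qed.

(** A solution is a fixed point of the map that sends x to inc u, where u
    solves S u z + kap (inc u, inc z) = (kap x - Q x, inc z). Coercivity gains
    gam + kap on the left; on the right, expanding |kap d - (Q x - Q y)|^2 with
    d = x - y and using that Q is almost monotone leaves (kap^2 + 2 kap ep +
    ell^2) |d|^2. *)
Lemma semilinear_solvable : exists2 u, W u &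
  forall z, W z -> S u z + ip (Q (inc u)) (inc z) = 0.
Proof.
have [s sP] := choice damped_solution.
pose f x := inc (s (kap *: x - Q x)).
pose t := (kap ^+ 2 + 2 * kap * ep + ell ^+ 2) / (gam + kap) ^+ 2.
have gk0 : 0 < gam + kap by exact: ltr_wpDr.
have t0 : 0 <= t.
  rewrite divr_ge0 ?sqr_ge0//; have := mulr_ge0 kap_ge0 ep_ge0.
  by have := sqr_ge0 kap; have := sqr_ge0 ell; lra.
have t1 : t < 1.
  rewrite ltr_pdivrMr ?exprn_gt0// mul1r.
  have -> : ell ^+ 2 = kap * (gam - ep) by rewrite /kap divfK// gt_eqF.
  have := mulr_ge0 kap_ge0 (ltW gap).
  have : 0 < gam ^+ 2 by rewrite exprn_gt0.
  by rewrite sqrrD; lra.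
have f_lip x y : `|f x - f y| <= Num.sqrt t * `|x - y|.
  rewrite -(@ler_pXn2r _ 2)// ?nnegrE ?mulr_ge0 ?sqrtr_ge0//.
  rewrite exprMn sqr_sqrtr//.
  have [Wx xP] := sP (kap *: x - Q x); have [Wy yP] := sP (kap *: y - Q y).
  set u := s _ in Wx xP; set v := s _ in Wy yP.
  have -> : f x - f y = inc (u - v) by rewrite linearB.
  have uvE : u - v = -1 *: v + u by rewrite scaleN1r addrC.
  have Wuv : W (u - v) by rewrite uvE; exact: W_sub.2.
  have E : S (u - v) (u - v) + kap * `|inc (u - v)| ^+ 2 =
      ip (kap *: (x - y) - (Q x - Q y)) (inc (u - v)).
    have := xP _ Wuv; have := yP _ Wuv; rewrite hilb.
    have -> : S (u - v) (u - v) = S u (u - v) - S v (u - v).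
      by rewrite {1}uvE S_lin//; ring.
    have -> : ip (inc (u - v)) (inc (u - v)) =
      ip (inc u) (inc (u - v)) - ip (inc v) (inc (u - v)).
      by rewrite {1}linearB ipDl ipNl.
    by move: (inc (u - v)) => w; rewrite !ipE => h1 h2; lra.
  have h : (gam + kap) * `|inc (u - v)| ^+ 2 <=
      `|kap *: (x - y) - (Q x - Q y)| * `|inc (u - v)|.
    apply: le_trans (cauchy_schwarz hilb _ _); rewrite -E mulrDl lerD2r.
    by apply: le_trans (S_coercive Wuv); rewrite lerDr mulr_ge0 ?sqr_ge0// ltW.
  have {}h := le_of_sqr gk0 (normr_ge0 _) (normr_ge0 _) h.
  apply: le_trans (lerXn2r 2 _ _ h) _; rewrite ?nnegrE//.
    by rewrite mulr_ge0// invr_ge0 ltW.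
  rewrite exprMn exprVn /t mulrAC mulrC ler_wpM2r ?invr_ge0 ?sqr_ge0//.
  have := Q_mon x y.
  have : `|Q x - Q y| ^+ 2 <= ell ^+ 2 * `|x - y| ^+ 2.
    rewrite -exprMn ler_pXn2r// ?nnegrE//.
    exact: le_trans (normr_ge0 _) (Q_lip x y).
  rewrite !hilb; move: (x - y) (Q x - Q y) => d m mell /(ler_wpM2l kap_ge0) mon.
  by rewrite !ipE (ipC ip d m); lra.
have [||x fx] := @contraction_fixpoint R H f (Num.sqrt t) _ _ f_lip.
- exact: sqrtr_ge0.
- by rewrite -sqrtr1 ltr_sqrt.
have [Wu uP] := sP (kap *: x - Q x).
exists (s (kap *: x - Q x)) => // z Wz.
have := uP _ Wz; rewrite -/(f x) fx ipDl ipNl ipZl; lra.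
Qed.

End SemilinearEquation.

(** * One time step *)

Lemma to_dual_ge0 (R : realType) (V : normedModType R) (W : set V)
    (S : V -> V -> R) (w : V) :
  linear_subspace W -> bounded_linear_to_dual W S -> monotone_to_dual W S ->
  W w -> 0 <= S w w.
Proof.
move=> Wsub [_ Slin _] Smon Ww; have := Smon w 0 Ww Wsub.1; rewrite subr0.
have := Slin 1 0 0 w Wsub.1 Wsub.1 Ww; rewrite scaler0 addr0 mul1r.
lra.
Qed.

Definition one_step (R : realType) (H : completeNormedModType R)
    (A1 B A2 Phi : operator H) (L calL : H -> H) (h : R) (F th0 ph0 v0 : H)
    (th ph : H) : Prop :=
  let v := h^-1 *: (ph - ph0) in
  [/\ dom A1 th /\ dom B v, dom A2 ph /\ dom Phi ph,
      h^-1 *: (th - th0) + v + A1 th = F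
    & L (h^-1 *: (v - v0)) + B v + A2 ph + Phi ph + calL ph = th].

Section OneStep.
Variables (R : realType) (V H : completeNormedModType R).
Variables (ip : {dot H for idfun}) (inc : {linear V -> H}) (V2 : set V).
Variables (L : {linear H -> H}) (cL : R) (A1 B A2 Phi : operator H).
Variables (Bs A2s : V -> V -> R) (calL : H -> H) (C h : R).
Hypothesis hilb : induces_norm ip.
Hypothesis inc_cont : continuous inc.
Hypotheses (V2_sub : linear_subspace V2) (V2_closed : closed V2).
Hypothesis L_bounded : exists C : R, forall w, `|L w| <= C * `|w|.
Hypothesis L_sym : forall w z, ip (L w) z = ip w (L z).
Hypothesis L_coercive : forall w, cL * `|w| ^+ 2 <= ip (L w) w.
Hypotheses (A1_lin : linear_operator A1) (A1_mm : maximal_monotone ip A1).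
Hypotheses (B_lin : linear_operator B) (B_mm : maximal_monotone ip B).
Hypothesis B_sa : selfadjoint ip B.
Hypotheses (A2_lin : linear_operator A2) (A2_mm : maximal_monotone ip A2).
Hypothesis A2_sa : selfadjoint ip A2.
Hypothesis BA2_ge0 :
  forall w, (dom B `&` dom A2) w -> 0 <= ip (B w) (A2 w).
Hypothesis Phi_mm : maximal_monotone ip Phi.
Hypothesis Phi_yosida : forall lam : R, 0 < lam ->
  [/\ yosida Phi lam 0 = 0,
      forall w, dom B w -> 0 <= ip (yosida Phi lam w) (B w)
    & forall w, dom A2 w -> 0 <= ip (yosida Phi lam w) (A2 w)].
Hypothesis Bs_bounded : bounded_linear_to_dual V2 Bs.
Hypothesis Bs_mon : monotone_to_dual V2 Bs.
Hypothesis Bs_sym : symmetric_to_dual V2 Bs.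
Hypothesis A2s_bounded : bounded_linear_to_dual V2 A2s.
Hypothesis A2s_sym : symmetric_to_dual V2 A2s.
Hypothesis A2s_coercive : forall alpha : R, 0 < alpha ->
  exists omega : R, 0 < omega /\ forall w, V2 w ->
    omega * `|w| ^+ 2 <= A2s w w + alpha * `|inc w| ^+ 2.
Hypothesis BA2_regular : forall (g : H) (a b c d lam : R) (phi : V),
  0 < a -> 0 < b -> 0 < c -> 0 < d -> 0 < lam -> V2 phi ->
  (forall z, V2 z ->
     ip (L (inc phi)) (inc z) + a * Bs phi z + b * A2s phi z
       + c * ip (yosida Phi lam (inc phi)) (inc z)
       + d * ip (calL (inc phi)) (inc z) = ip g (inc z)) ->
  (dom B `&` dom A2) (inc phi) /\
  L (inc phi) + a *: B (inc phi) + b *: A2 (inc phi)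
    + c *: yosida Phi lam (inc phi) + d *: calL (inc phi) = g.
Hypothesis C_gt0 : 0 < C.
Hypothesis calL_lip : forall w z, `|calL w - calL z| <= C * `|w - z|.
Hypothesis h_gt0 : 0 < h.
Hypothesis h_small : h ^+ 2 * C < cL.

Let h2_gt0 : 0 < h ^+ 2. Proof. by rewrite exprn_gt0. Qed.

(** The equation for phi alone: the temperature is resolvent A1 h (G - phi),
    and G and g depend on the previous time step. *)
Section ReducedEquation.
Variables (G g : H).

Let P (x : H) := h ^+ 2 *: (calL x - resolvent A1 h (G - x)) - g.

Let P_B x y : P x - P y = h ^+ 2 *: ((calL x - calL y)
  - (resolvent A1 h (G - x) - resolvent A1 h (G - y))).
Proof.
rewrite /P opprB addrA subrK -scalerBr; congr (_ *: _).
by rewrite !opprD !opprK addrACA.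
Qed.

Let G_B x y : G - x - (G - y) = y - x.
Proof. by rewrite opprB addrC addrA subrK. Qed.

Let P_lip x y : `|P x - P y| <= h ^+ 2 * (C + 1) * `|x - y|.
Proof.
rewrite P_B normrZ (gtr0_norm h2_gt0) -mulrA ler_pM2l// mulrDl mul1r.
apply: le_trans (ler_normB _ _) _; apply: lerD; first exact: calL_lip.
rewrite (distrC x) -(G_B x y).
exact: (resolvent_nonexpansive hilb A1_mm h_gt0).
Qed.

(** The resolvent contributes nonnegatively, being monotone and evaluated at
    G - x with the sign -1; only calL is lost. *)
Let P_mon x y : - (h ^+ 2 * C * `|x - y| ^+ 2) <= ip (P x - P y) (x - y).
Proof.
rewrite P_B ipZl -mulrA -mulrN ler_pM2l// ipDl ipNl.
have firm : ip (resolvent A1 h (G - x) - resolvent A1 h (G - y)) (x - y) <= 0.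
  have -> : x - y = - (G - x - (G - y)) by rewrite G_B opprB.
  rewrite ipNr oppr_le0.
  exact: le_trans (sqr_ge0 _) (resolvent_firm hilb A1_mm h_gt0 _ _).
have := cauchy_schwarz hilb (- (calL x - calL y)) (x - y).
rewrite normrN ipNl => cs.
have := ler_wpM2r (normr_ge0 (x - y)) (calL_lip x y); rewrite -mulrA -expr2.
by move: cs firm; lra.
Qed.

Let form u z := ip (L (inc u)) (inc z) + h * Bs u z + h ^+ 2 * A2s u z.

Let regularized_solvable (lam : R) : 0 < lam -> exists x,
  (dom B `&` dom A2) x
  /\ L x + P x + h *: B x + h ^+ 2 *: A2 x + h ^+ 2 *: yosida Phi lam x = 0.
Proof.
move=> lam0.
have [_ Blin [CB [CB0 Bbd]]] := Bs_bounded.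
have [_ Alin [CA [CA0 Abd]]] := A2s_bounded.
have [CL Lbd] := L_bounded.
have [Ci Ci0 incC] := continuous_linear_bound inc_cont.
(* half of the gap cL - ep goes to the coercivity of A2s, the other half keeps
   the constant of the form above ep *)
pose ep := h ^+ 2 * C; pose al := (cL - ep) / 2 / h ^+ 2.
have al0 : 0 < al by rewrite !divr_gt0// subr_gt0.
have [om [om0 omP]] := A2s_coercive al0.
have [|||||||||u V2u uP] := @semilinear_solvable R V H ip inc V2 form
  (fun x => P x + h ^+ 2 *: yosida Phi lam x) (h ^+ 2 * om)
  (`|CL| * Ci * Ci + h * CB + h ^+ 2 * CA) ((cL + ep) / 2) ep
  (h ^+ 2 * (C + 1) + h ^+ 2 * lam^-1) hilb inc_cont V2_sub V2_closed.
- move=> t u v z V2u V2v V2z; rewrite /form Blin// Alin// !linearP ipDl ipZl.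
  by ring.
- by move=> u v V2u V2v; rewrite /form Bs_sym// A2s_sym// L_sym ipC.
- move=> u v V2u V2v; rewrite /form !mulrDl.
  apply: le_trans (ler_normD _ _) _; apply: lerD; last first.
    rewrite normrM (gtr0_norm h2_gt0) -2!mulrA ler_pM2l// mulrA.
    exact: (Abd u V2u).2.
  apply: le_trans (ler_normD _ _) _; apply: lerD; last first.
    rewrite normrM (gtr0_norm h_gt0) -2!mulrA ler_pM2l// mulrA.
    exact: (Bbd u V2u).2.
  apply: le_trans (cauchy_schwarz_norm hilb _ _) _.
  have -> : `|CL| * Ci * Ci * `|u| * `|v| = (`|CL| * (Ci * `|u|)) * (Ci * `|v|).
    by ring.
  apply: ler_pM => //; apply: le_trans (Lbd _) _.
  apply: le_trans (_ : `|CL| * `|inc u| <= _); last by rewrite ler_wpM2l.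
  by rewrite ler_wpM2r// ler_norm.
- by rewrite mulr_gt0.
- move=> u V2u; rewrite /form; have := L_coercive (inc u).
  have := mulr_ge0 (ltW h_gt0) (to_dual_ge0 V2_sub Bs_bounded Bs_mon V2u).
  have := ler_wpM2l (ltW h2_gt0) (omP u V2u).
  have -> : h ^+ 2 * (A2s u u + al * `|inc u| ^+ 2) =
      h ^+ 2 * A2s u u + (cL - ep) / 2 * `|inc u| ^+ 2.
    by rewrite /al; field; rewrite gt_eqF.
  by lra.
- by rewrite mulr_ge0 ?(ltW h2_gt0)// ltW.
- by have : ep < cL by []; lra.
- move=> x y; rewrite opprD addrACA -scalerBr ipDl ipZl.
  apply: le_trans (P_mon x y) _; rewrite lerDl mulr_ge0 ?(ltW h2_gt0)//.
  exact: yosida_monotone.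
- move=> x y; rewrite opprD addrACA -scalerBr mulrDl.
  apply: le_trans (ler_normD _ _) _; apply: lerD; first exact: P_lip.
  rewrite normrZ (gtr0_norm h2_gt0) -mulrA ler_pM2l//.
  exact: yosida_lipschitz.
have [|x_dom xE] := BA2_regular (g := g + h ^+ 2 *: resolvent A1 h (G - inc u))
  h_gt0 h2_gt0 h2_gt0 h2_gt0 lam0 V2u.
  move=> z V2z; have := uP z V2z; rewrite /form /P.
  move: (yosida _ _ _) (resolvent _ _ _) => y j.
  by rewrite !ipE; lra.
exists (inc u); split=> //; move: xE; rewrite /P.
move: (yosida _ _ _) (resolvent _ _ _) => y j xE.
apply: (@ip_inj _ _ _ hilb) => w.
have := congr1 (ip^~ w) xE; rewrite /= !ipE; lra.
Qed.

Lemma reduced_solvable : exists x,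
  [/\ (dom B `&` dom A2) x, dom Phi x
    & L x + h *: B x + h ^+ 2 *: A2 x + h ^+ 2 *: Phi x + h ^+ 2 *: calL x
      = g + h ^+ 2 *: resolvent A1 h (G - x)].
Proof.
have [CL Lbd] := L_bounded.
have [||||x [x_dom Px xE]] := @vanishing_yosida R H ip (fun x => L x + P x)
  B A2 Phi (cL - h ^+ 2 * C) (`|CL| + h ^+ 2 * (C + 1)) h (h ^+ 2) (h ^+ 2)
  hilb _ _ h_gt0 h2_gt0 h2_gt0 _ _ B_lin B_mm B_sa A2_lin A2_mm A2_sa BA2_ge0
  Phi_mm Phi_yosida regularized_solvable.
- by rewrite subr_gt0.
- by rewrite addr_ge0// mulr_ge0 ?(ltW h2_gt0)// addr_ge0// ltW.
- move=> x y; rewrite opprD addrACA -linearB ipDl mulrBl lerD//.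
- move=> x y; rewrite opprD addrACA -linearB mulrDl.
  apply: le_trans (ler_normD _ _) _; apply: lerD; last exact: P_lip.
  by apply: le_trans (Lbd _) _; rewrite ler_wpM2r// ler_norm.
exists x; split=> //; move: xE; rewrite /P.
move: (resolvent _ _ _) => j xE.
apply: (@ip_inj _ _ _ hilb) => w.
have := congr1 (ip^~ w) xE; rewrite /= !ipE; lra.
Qed.

End ReducedEquation.

Lemma one_step_exists (F th0 ph0 v0 : H) : dom B ph0 -> exists th ph,
  [/\ one_step A1 B A2 Phi L calL h F th0 ph0 v0 th ph & dom B ph].
Proof.
move=> Bph0.
pose G := h *: F + th0 + ph0.
have [x [[Bx A2x] Px xE]] :=
  reduced_solvable G (L ph0 + h *: L v0 + h *: B ph0).
have [A1th thE] := resolventP hilb A1_mm h_gt0 (G - x).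
move: xE A1th thE; set th := resolvent _ _ _ => xE A1th thE.
have hV : h != 0 by rewrite gt_eqF.
exists th, x; split=> //; rewrite /one_step.
have [Bd BdE] := linear_operatorB B_lin Bx Bph0.
have Bv : dom B (h^-1 *: (x - ph0)) /\
    B (h^-1 *: (x - ph0)) = h^-1 *: (B x - B ph0).
  have [B0 B0E] := linear_operatorB B_lin Bx Bx.
  rewrite subrr in B0 B0E; rewrite subrr in B0E.
  rewrite -[_ *: (x - _)]addr0; split; first exact: B_lin.1.2.
  by rewrite B_lin.2// BdE B0E addr0.
split=> //.
- by split=> //; case: Bv.
- apply: (@ip_inj _ _ _ hilb) => w.
  have := congr1 (ip^~ w) thE; rewrite /G /= !ipE => E.
  apply: (mulfI hV); rewrite !mulrDr.
  have -> : h * ip F w =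
      ip th w + h * ip (A1 th) w - ip th0 w - ip ph0 w + ip x w.
    by lra.
  by field.
- rewrite Bv.2; apply: (@ip_inj _ _ _ hilb) => w.
  have -> : L (h^-1 *: (h^-1 *: (x - ph0) - v0)) =
      h^-1 *: (h^-1 *: (L x - L ph0) - L v0).
    by rewrite linearZ_LR (linearB L) linearZ_LR (linearB L).
  have := congr1 (ip^~ w) xE; rewrite /= !ipE => E.
  have h2V : h ^+ 2 != 0 by rewrite gt_eqF.
  apply: (mulfI h2V).
  have -> : h ^+ 2 * ip th w =
    ip (L x) w + h * ip (B x) w + h ^+ 2 * ip (A2 x) w
    + h ^+ 2 * ip (Phi x) w + h ^+ 2 * ip (calL x) w
    - (ip (L ph0) w + h * ip (L v0) w + h * ip (B ph0) w) by lra.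
  by field.
Qed.

(** Let e and d be the differences in theta and phi.  The first equation tested
    with e gives (d, e) <= - |e|^2 <= 0, so the right hand side of the second
    equation tested with d is nonpositive.  Its left hand side is at least
    (cL / h^2 - C) |d|^2, hence d = 0, and then e = 0. *)
Lemma one_step_unique (F th0 ph0 v0 th ph th' ph' : H) :
  one_step A1 B A2 Phi L calL h F th0 ph0 v0 th ph ->
  one_step A1 B A2 Phi L calL h F th0 ph0 v0 th' ph' ->
  th = th' /\ ph = ph'.
Proof.
move=> [[A1th Bv] [A2ph Pph] E1 E2] [[A1th' Bv'] [A2ph' Pph'] E1' E2'].
have [Ae AeE] := linear_operatorB A1_lin A1th A1th'.
have [Bw BwE] := linear_operatorB B_lin Bv Bv'.
have [Ad AdE] := linear_operatorB A2_lin A2ph A2ph'.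
have mA1 := linear_monotone_ge0 A1_lin A1_mm Ae.
have mB := linear_monotone_ge0 B_lin B_mm Bw.
have mA2 := linear_monotone_ge0 A2_lin A2_mm Ad.
have mPhi := monotone_operator Phi_mm Pph Pph'.
have hV : h != 0 by rewrite gt_eqF.
have h2V : h ^+ 2 != 0 by rewrite gt_eqF.
rewrite AeE in mA1; rewrite BwE in mB; rewrite AdE in mA2.
have wE : h^-1 *: (ph - ph0) - h^-1 *: (ph' - ph0) = h^-1 *: (ph - ph').
  by rewrite -scalerBr opprB addrA subrK.
have T1 : h^-1 * (ip (th - th') (th - th') + ip (ph - ph') (th - th'))
    + ip (A1 th - A1 th') (th - th') = 0.
  rewrite -ipDl -ipZl -ipDl -[RHS](ip0l ip (th - th')); congr (ip _ _).
  apply: (@ip_inj _ _ _ hilb) => w.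
  have := congr1 (ip^~ w) E1; have := congr1 (ip^~ w) E1'.
  by rewrite /= !ipE; lra.
have T2 : h^-1 * (h^-1 * ip (L (ph - ph')) (ph - ph'))
    + ip (B (h^-1 *: (ph - ph0)) - B (h^-1 *: (ph' - ph0))) (ph - ph')
    + ip (A2 ph - A2 ph') (ph - ph') + ip (Phi ph - Phi ph') (ph - ph')
    + ip (calL ph - calL ph') (ph - ph') = ip (th - th') (ph - ph').
  have LE : L (h^-1 *: (h^-1 *: (ph - ph0) - v0))
      - L (h^-1 *: (h^-1 *: (ph' - ph0) - v0)) =
      h^-1 *: (h^-1 *: L (ph - ph')).
    by rewrite -(linearB L) -scalerBr opprB addrA subrK wE !linearZ_LR.
  rewrite -!ipZl -LE -!ipDl; congr (ip _ _).
  apply: (@ip_inj _ _ _ hilb) => w.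
  have := congr1 (ip^~ w) E2; have := congr1 (ip^~ w) E2'.
  by rewrite /= !ipE; lra.
set d := ph - ph' in wE mA2 mPhi T1 T2; set e := th - th' in mA1 T1 T2.
rewrite wE ipZr pmulr_rge0 ?invr_gt0// in mB.
have de : ip e d <= 0.
  have e0 := ip_ge0 hilb e; rewrite ipC.
  move: mA1; have -> : ip (A1 th - A1 th') e = - h^-1 * (ip e e + ip d e).
    by rewrite mulNr; lra.
  by rewrite mulNr oppr_ge0 pmulr_rle0 ?invr_gt0//; lra.
have d0 : d = 0.
  have cs := cauchy_schwarz hilb (- (calL ph - calL ph')) d.
  rewrite ipNl normrN in cs.
  have lip := ler_wpM2r (normr_ge0 d) (calL_lip ph ph').
  rewrite -/d -mulrA -expr2 in lip.
  have : h^-1 * (h^-1 * (cL * `|d| ^+ 2)) <= C * `|d| ^+ 2.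
    apply: le_trans (_ : h^-1 * (h^-1 * ip (L d) d) <= _).
      by rewrite !ler_pM2l ?invr_gt0.
    by lra.
  rewrite mulrA -invfM -expr2 ler_pdivrMl// => hd.
  have : (cL - h ^+ 2 * C) * `|d| ^+ 2 <= 0 by lra.
  rewrite pmulr_rle0 ?subr_gt0// => h0.
  by apply/eqP; rewrite -normr_eq0 -sqrf_eq0 eq_le h0 sqr_ge0.
have e0 : e = 0.
  apply/eqP; rewrite -normr_eq0 -sqrf_eq0 hilb; apply/eqP.
  move: T1; rewrite d0 ip0l addr0 => T1.
  have e0 := ip_ge0 hilb e.
  have : 0 <= h^-1 * ip e e by rewrite mulr_ge0// invr_ge0 ltW.
  move=> he; have /eqP : h^-1 * ip e e = 0 by lra.
  by rewrite mulf_eq0 invr_eq0 (negPf hV) => /eqP.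
by split; apply: subr0_eq.
Qed.

End OneStep.

(** * The discrete problem *)

Theorem theorem1p1 (R : realType) (T : R)
  (V H : completeNormedModType R)
  (ipV : {dot V for idfun}) (ipH : {dot H for idfun})
  (inc : {linear V -> H})
  (V1 V2 : set V)
  (L : {linear H -> H}) (cL : R)
  (A1 B A2 Phi : operator H)
  (A1s Bs A2s : V -> V -> R)
  (p q CPhi : R)
  (calL : H -> H) (CcalL : R)
  (theta0 phi0 v0 : H) (f : R -> H)
  (T_gt0 : 0 < T)
  (* (C1) *)
  (hilbV : induces_norm ipV) (hilbH : induces_norm ipH)
  (inc_inj : injective inc) (inc_cont : continuous inc)
  (inc_dense : dense (range inc))
  (inc_compact : forall E : set V, bounded_set E -> precompact (inc @` E))
  (* (C2) *)
  (V1_sub : linear_subspace V1) (V1_closed : closed V1)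
  (V1_dense : dense (inc @` V1)) (V1_refl : reflexive_subspace V1)
  (V2_sub : linear_subspace V2) (V2_closed : closed V2)
  (V2_dense : dense (inc @` V2)) (V2_refl : reflexive_subspace V2)
  (* (C3) *)
  (L_bounded : exists C : R, forall w, `|L w| <= C * `|w|)
  (L_sym : forall w z, ipH (L w) z = ipH w (L z))
  (cL_gt0 : 0 < cL)
  (L_coercive : forall w, cL * `|w| ^+ 2 <= ipH (L w) w)
  (* (C4) *)
  (A1_linear : linear_operator A1) (A1_maxmon : maximal_monotone ipH A1)
  (A1_selfadj : selfadjoint ipH A1)
  (A1_dom : dom A1 `<=` inc @` V1)
  (A1s_bounded : bounded_linear_to_dual V1 A1s)
  (A1s_mon : monotone_to_dual V1 A1s)
  (A1s_sym : symmetric_to_dual V1 A1s)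
  (A1s_ext : forall w z, V1 w -> dom A1 (inc w) -> V1 z ->
     A1s w z = ipH (A1 (inc w)) (inc z))
  (A1s_coercive : forall alpha : R, 0 < alpha -> exists sigma : R, 0 < sigma /\
     forall w, V1 w -> sigma * `|w| ^+ 2 <= A1s w w + alpha * `|inc w| ^+ 2)
  (* (C5) *)
  (A1_regular : forall (g : H) (a : R) (theta : V), 0 < a -> V1 theta ->
     (forall z, V1 z ->
        ipH (inc theta) (inc z) + a * A1s theta z = ipH g (inc z)) ->
     dom A1 (inc theta) /\ inc theta + a *: A1 (inc theta) = g)
  (* (C6) *)
  (B_linear : linear_operator B) (B_maxmon : maximal_monotone ipH B)
  (B_selfadj : selfadjoint ipH B)
  (A2_linear : linear_operator A2) (A2_maxmon : maximal_monotone ipH A2)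
  (A2_selfadj : selfadjoint ipH A2)
  (BA2_dom : dom B `&` dom A2 !=set0)
  (BA2_ge0 : forall w, (dom B `&` dom A2) w -> 0 <= ipH (B w) (A2 w))
  (BA2_sym : forall w z, (dom B `&` dom A2) w -> (dom B `&` dom A2) z ->
     ipH (B w) (A2 z) = ipH (B z) (A2 w))
  (A2_dom : dom A2 `<=` inc @` V2)
  (* (C7) *)
  (Phi_maxmon : maximal_monotone ipH Phi) (Phi0 : Phi 0 = 0)
  (Phi_dom : range inc `<=` dom Phi)
  (p_gt0 : 0 < p) (q_gt0 : 0 < q) (CPhi_gt0 : 0 < CPhi)
  (Phi_lip : forall w z : V,
     `|Phi (inc w) - Phi (inc z)|
       <= CPhi * (1 + `|w| `^ p + `|z| `^ q) * `|w - z|)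
  (* (C8) *)
  (Phi_i : exists i : V -> R, (forall w, 0 <= i w) /\
     forall w z : V, i w - i z <= ipH (Phi (inc w)) (inc w - inc z))
  (* (C9) *)
  (Phi_yosida : forall lam : R, 0 < lam ->
     [/\ yosida Phi lam 0 = 0,
         forall w, dom B w -> 0 <= ipH (yosida Phi lam w) (B w)
       & forall w, dom A2 w -> 0 <= ipH (yosida Phi lam w) (A2 w)])
  (* (C10) *)
  (Bs_bounded : bounded_linear_to_dual V2 Bs)
  (Bs_mon : monotone_to_dual V2 Bs)
  (Bs_sym : symmetric_to_dual V2 Bs)
  (Bs_ext : forall w z, V2 w -> dom B (inc w) -> V2 z ->
     Bs w z = ipH (B (inc w)) (inc z))
  (* (C11) *)
  (A2s_bounded : bounded_linear_to_dual V2 A2s)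
  (A2s_mon : monotone_to_dual V2 A2s)
  (A2s_sym : symmetric_to_dual V2 A2s)
  (A2s_ext : forall w z, V2 w -> dom A2 (inc w) -> V2 z ->
     A2s w z = ipH (A2 (inc w)) (inc z))
  (A2s_coercive : forall alpha : R, 0 < alpha -> exists omega : R, 0 < omega /\
     forall w, V2 w -> omega * `|w| ^+ 2 <= A2s w w + alpha * `|inc w| ^+ 2)
  (* (C12) *)
  (BA2_regular : forall (g : H) (a b c d lam : R) (phi : V),
     0 < a -> 0 < b -> 0 < c -> 0 < d -> 0 < lam -> V2 phi ->
     (forall z, V2 z ->
        ipH (L (inc phi)) (inc z) + a * Bs phi z + b * A2s phi z
          + c * ipH (yosida Phi lam (inc phi)) (inc z)
          + d * ipH (calL (inc phi)) (inc z) = ipH g (inc z)) ->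
     (dom B `&` dom A2) (inc phi) /\
     L (inc phi) + a *: B (inc phi) + b *: A2 (inc phi)
       + c *: yosida Phi lam (inc phi) + d *: calL (inc phi) = g)
  (* (C13) *)
  (CcalL_gt0 : 0 < CcalL)
  (calL_lip : forall w z, `|calL w - calL z| <= CcalL * `|w - z|)
  (* (C14) *)
  (theta0_in : (inc @` V1) theta0)
  (phi0_in : (dom B `&` dom A2) phi0)
  (v0_in : (dom B `&` inc @` V2) v0)
  (f_L2 : square_integrable `]0, T[ f) :
  exists h0 : R, (0 < h0 < 1) /\
    forall N : nat, (0 < N)%N -> T / N%:R < h0 ->
    let sol := discrete_solution A1 B A2 Phi L calL theta0 phi0 v0 f
                 (T / N%:R) N in
    exists theta phi : nat -> H,
      [/\ sol theta phi,
          forall n, (n < N)%N ->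
            dom A1 (theta n.+1) /\ (dom B `&` dom A2) (phi n.+1)
        & forall theta' phi' : nat -> H, sol theta' phi' ->
            forall n, (n < N)%N ->
              theta' n.+1 = theta n.+1 /\ phi' n.+1 = phi n.+1].
Proof.
exists (Num.min 2^-1 (cL / CcalL)); split.
  rewrite lt_min invr_gt0 ltr0n/= divr_gt0//= (@le_lt_trans _ _ 2^-1)//.
    by rewrite ge_min lexx.
  by rewrite invf_lt1// ltr1n.
move=> N N_gt0; set h := T / N%:R; rewrite lt_min => /andP[h_half h_cL] sol.
have h_gt0 : 0 < h by rewrite divr_gt0// ltr0n.
have h_small : h ^+ 2 * CcalL < cL.
  rewrite ltr_pdivlMr// in h_cL; apply: le_lt_trans h_cL.
  rewrite ler_pM2r// expr2 ger_pMl//.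
  by rewrite (le_trans (ltW h_half))// invf_le1// ler1n.
(* s = (theta, phi, v) is the state at time n *)
have solve n (s : H * H * H) : exists p : H * H, dom B s.1.2 ->
    one_step A1 B A2 Phi L calL h (time_average f h n.+1)
      s.1.1 s.1.2 s.2 p.1 p.2 /\ dom B p.2.
  have [Bs2|nB] := pselect (dom B s.1.2); last by exists (0, 0).
  have [th [ph [step Bph]]] := one_step_exists hilbH inc_cont V2_sub V2_closed
    L_bounded L_sym L_coercive A1_maxmon B_linear B_maxmon B_selfadj A2_linear
    A2_maxmon A2_selfadj BA2_ge0 Phi_maxmon Phi_yosida Bs_bounded Bs_mon Bs_sym
    A2s_bounded A2s_sym A2s_coercive BA2_regular CcalL_gt0 calL_lip h_gt0
    h_small
    (time_average f h n.+1) s.1.1 s.2 Bs2.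
  by exists (th, ph).
have [nxt nxtP] := choice (fun ns : nat * (H * H * H) => solve ns.1 ns.2).
pose fix state n : H * H * H := if n is m.+1 then
  let p := nxt (m, state m) in (p.1, p.2, h^-1 *: (p.2 - (state m).1.2))
  else (theta0, phi0, v0).
have B_state n : dom B (state n).1.2.
  by elim: n => [|n IH]; [case: phi0_in|exact: (nxtP (n, state n) IH).2].
have step n := (nxtP (n, state n) (B_state n)).1.
pose v n := (state n).2.
exists (fun n => (state n).1.1), (fun n => (state n).1.2); split.
(* with n.-1, the value of z at 0 is its value at 1 *)
- split=> //; exists v, (fun n => diff_quot h v n.-1); split=> // n nN.
  by have [] := step n.
- by move=> n nN; have [[? _] [? _] _ _] := step n; split=> //; split.
- move=> theta' phi' [th0E ph0E [v' [z' [v0E _ sol']]]].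
  have same n : (n <= N)%N -> [/\ theta' n = (state n).1.1,
      phi' n = (state n).1.2 & v' n = v n].
    elim: n => [_|n IH nN]; first by split.
    have [thE phE vE] := IH (ltnW nN).
    have [[A1th Bv] [A2ph Pph] E1 E2 [zE vE']] := sol' n nN.
    have step' : one_step A1 B A2 Phi L calL h (time_average f h n.+1)
        (state n).1.1 (state n).1.2 (state n).2 (theta' n.+1) (phi' n.+1).
      rewrite zE /diff_quot vE' /diff_quot vE phE in E2.
      rewrite /diff_quot thE phE in E1.
      by rewrite vE' /diff_quot phE in Bv; split.
    have [thS phS] := one_step_unique hilbH L_coercive A1_linear A1_maxmon
      B_linear B_maxmon A2_linear A2_maxmon Phi_maxmon calL_lip h_gt0 h_small
      step' (step n).
    by split=> //; rewrite vE' /diff_quot phE phS.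
  by move=> n nN; have [-> ->] := same n.+1 nN.
Qed.
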